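(* Let $(M,g)$ be a closed (i.e. compact without boundary) connected Lorentzian manifold with Levi-Civita connection $D$. Then any smooth function $\alpha:M\to\mathbb{R}$ satisfying, for all vectors $X,Y,Z$ tangent to $M$ at a common point, $$DDD\alpha(X,Y,Z)+2(D\alpha\otimes g)(X,Y,Z)+(D\alpha\otimes g)(Y,X,Z)+(D\alpha\otimes g)(Z,X,Y)=0$$ is constant.
   Context: Lorentzian means of signature $(n-1,1)$ or $(1,n-1)$, where $n=\dim M\ge 2$. Here $(D\alpha\otimes g)(X,Y,Z)=D\alpha(X)\,g(Y,Z)$, where $D\alpha=d\alpha$; $DD\alpha$ is the Hessian of $\alpha$, and $DDD\alpha(X,Y,Z)=(D_X(DD\alpha))(Y,Z)$. *)

(* Defs.v *)
From mathcomp Require Import all_boot all_order all_algebra.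
From mathcomp Require Import all_classical all_reals all_analysis.

Set Implicit Arguments.
Unset Strict Implicit.
Unset Printing Implicit Defensive.

Import Order.TTheory GRing.Theory Num.Theory.
Import numFieldNormedType.Exports.

Local Open Scope classical_set_scope.
Local Open Scope ring_scope.

Section Smoothness.
Variables (R : realType) (n : nat) (W : normedModType R).

Definition partial_deriv (a : 'I_n) (f : 'rV[R]_n -> W) : 'rV[R]_n -> W :=
  'D_(delta_mx 0 a) f.

Definition iter_partial (s : seq 'I_n) (f : 'rV[R]_n -> W) : 'rV[R]_n -> W :=
  foldr partial_deriv f s.

(* Only used for open U, so that the values of f outside U are irrelevant. *)
Definition smooth_on (U : set 'rV[R]_n) (f : 'rV[R]_n -> W) : Prop :=
  forall (s : seq 'I_n) (x : 'rV[R]_n), U x ->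
    {for x, continuous (iter_partial s f)} /\
    forall a : 'I_n, derivable (iter_partial s f) x (delta_mx 0 a).

End Smoothness.

(* A homeomorphism from the open set chart_dom of T onto the open set chart_cod
   of R^n.
   The maps are total; their values outside chart_dom and chart_cod are
   irrelevant. *)
Record chart (R : realType) (n : nat) (T : topologicalType) := Chart {
  chart_dom : set T;
  chart_cod : set 'rV[R]_n;
  chart_coord : T -> 'rV[R]_n;
  chart_param : 'rV[R]_n -> T;
  open_dom : open chart_dom;
  open_cod : open chart_cod;
  coord_cod : forall p, chart_dom p -> chart_cod (chart_coord p);
  param_dom : forall x, chart_cod x -> chart_dom (chart_param x);
  coordK : forall p, chart_dom p -> chart_param (chart_coord p) = p;
  paramK : forall x, chart_cod x -> chart_coord (chart_param x) = x;
  continuous_coord : forall p, chart_dom p -> {for p, continuous chart_coord};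
  continuous_param : forall x, chart_cod x -> {for x, continuous chart_param}
}.

Definition chart_transition (R : realType) (n : nat) (T : topologicalType)
    (c c' : chart R n T) : 'rV[R]_n -> 'rV[R]_n :=
  chart_coord c' \o chart_param c.

Definition chart_overlap (R : realType) (n : nat) (T : topologicalType)
    (c c' : chart R n T) : set 'rV[R]_n :=
  chart_cod c `&` (chart_param c @^-1` chart_dom c').

Record manifold (R : realType) (n : nat) := Manifold {
  points :> topologicalType;
  hausdorff_points : hausdorff_space points;
  second_countable_points : @second_countable points;
  chart_index : Type;
  atlas : chart_index -> chart R n points;
  atlas_cover : forall p : points, exists i, chart_dom (atlas i) p;
  atlas_compatible : forall i j,
    smooth_on (chart_overlap (atlas i) (atlas j))
              (chart_transition (atlas i) (atlas j))
}.

Section Geometry.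
Variables (R : realType) (n : nat) (M : manifold R n).
Implicit Types i j : chart_index M.

Definition local_expr (alpha : M -> R) i : 'rV[R]_n -> R :=
  alpha \o chart_param (atlas i).

Definition smooth_function (alpha : M -> R) : Prop :=
  forall i, smooth_on (chart_cod (atlas i)) (local_expr alpha i).

(* gram i x is the matrix of g(d_a, d_b) at the point of coordinates x in the
   chart i.  'J f x has the derivative of f in the direction of the a-th
   coordinate as its a-th row. *)
Record pseudo_metric := PseudoMetric {
  gram : chart_index M -> 'rV[R]_n -> 'M[R]_n;
  gram_smooth : forall i, smooth_on (chart_cod (atlas i)) (gram i);
  gram_sym : forall i x, chart_cod (atlas i) x -> (gram i x)^T = gram i x;
  gram_nondegenerate : forall i x, chart_cod (atlas i) x -> gram i x \in unitmx;
  gram_change : forall i j x, chart_overlap (atlas i) (atlas j) x ->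
    let tau := chart_transition (atlas i) (atlas j) in
    gram i x = 'J tau x *m gram j (tau x) *m ('J tau x)^T
}.

Definition has_signature (G : 'M[R]_n) (p q : nat) : Prop :=
  (p + q)%N = n /\
  exists2 P : 'M[R]_n, P \in unitmx &
    P *m G *m P^T = diag_mx (\row_(k < n) (if (k < p)%N then 1 else -1)).

Definition metric_signature (g : pseudo_metric) (p q : nat) : Prop :=
  forall i x, chart_cod (atlas i) x -> has_signature (gram g i x) p q.

Definition lorentzian (g : pseudo_metric) : Prop :=
  metric_signature g n.-1 1 \/ metric_signature g 1 n.-1.

(* symbols i x a b is the row of components of D_{d_a} d_b in the chart i at
   the point of coordinates x; symbols_change is the rule obtained by applying
   D to the expression of the frame of the chart i in the one of j. *)
Record connection := Connection {
  symbols : chart_index M -> 'rV[R]_n -> 'I_n -> 'I_n -> 'rV[R]_n;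
  symbols_smooth : forall i a b,
    smooth_on (chart_cod (atlas i)) (fun x => symbols i x a b);
  symbols_change : forall i j x a b, chart_overlap (atlas i) (atlas j) x ->
    let tau := chart_transition (atlas i) (atlas j) in
    symbols i x a b *m 'J tau x =
      partial_deriv a (partial_deriv b tau) x +
      \sum_c \sum_d ('J tau x a c * 'J tau x b d) *: symbols j (tau x) c d
}.

(* Covariant tensor fields are given by their components in the chart i.  The
   first index of a covariant derivative is the direction of derivation. *)
Definition nabla1 (D : connection) i (w : 'I_n -> 'rV[R]_n -> R)
    (a b : 'I_n) (x : 'rV[R]_n) : R :=
  partial_deriv a (w b) x - \sum_k symbols D i x a b 0 k * w k x.

Definition nabla2 (D : connection) i (T : 'I_n -> 'I_n -> 'rV[R]_n -> R)
    (a b c : 'I_n) (x : 'rV[R]_n) : R :=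
  partial_deriv a (T b c) x - \sum_k symbols D i x a b 0 k * T k c x
                      - \sum_k symbols D i x a c 0 k * T b k x.

Definition torsion_free (D : connection) : Prop :=
  forall i x a b, chart_cod (atlas i) x ->
    symbols D i x a b = symbols D i x b a.

Definition metric_compatible (g : pseudo_metric) (D : connection) : Prop :=
  forall i x a b c, chart_cod (atlas i) x ->
    nabla2 D i (fun b c y => gram g i y b c) a b c x = 0.

Definition levi_civita (g : pseudo_metric) (D : connection) : Prop :=
  torsion_free D /\ metric_compatible g D.

Definition d_comp (alpha : M -> R) i (a : 'I_n) : 'rV[R]_n -> R :=
  partial_deriv a (local_expr alpha i).

Definition hess_comp (D : connection) (alpha : M -> R) i :=
  nabla1 D i (d_comp alpha i).

(* In what follows, p is a point of the domain of the chart i and the tangent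
   vectors X, Y, Z at p are given by their components in this chart. *)
Definition metric_at (g : pseudo_metric) i (p : M) (X Y : 'rV[R]_n) : R :=
  \sum_a \sum_b X 0 a * Y 0 b * gram g i (chart_coord (atlas i) p) a b.

Definition d_at (alpha : M -> R) i (p : M) (X : 'rV[R]_n) : R :=
  \sum_a X 0 a * d_comp alpha i a (chart_coord (atlas i) p).

Definition ddd_at (D : connection) (alpha : M -> R) i (p : M)
    (X Y Z : 'rV[R]_n) : R :=
  \sum_a \sum_b \sum_c X 0 a * Y 0 b * Z 0 c *
    nabla2 D i (hess_comp D alpha i) a b c (chart_coord (atlas i) p).

Definition d_tensor_metric (g : pseudo_metric) (alpha : M -> R) i (p : M)
    (X Y Z : 'rV[R]_n) : R :=
  d_at alpha i p X * metric_at g i p Y Z.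

End Geometry.

(* Main.v *)
From HB Require Import structures.
Require Import Defs.
From mathcomp Require Import all_boot all_order all_algebra.
From mathcomp Require Import ring lra.
From mathcomp Require Import all_classical all_reals all_analysis.
Import Order.TTheory GRing.Theory Num.Theory.
Import numFieldNormedType.Exports.
Local Open Scope classical_set_scope.
Local Open Scope ring_scope.

(** The equation says that a symmetric bilinear form on a bundle of rank n + 1
    is parallel, and such a form cannot stop being positive semidefinite.

    Let V = R + TM, with the form G of matrix diag(1, g), and let the connection
    send e, the generator of R, to X in the direction X, and a vector field Y to
    D_X Y - g(X, Y) e; this is the Levi-Civita connection of the metric cone over
    M, restricted to M.  Then G is parallel.  The form T given by

      T(e, e) = alpha,  T(e, X) = d alpha(X) / 2,
      T(X, Y) = DD alpha(X, Y) / 2 + alpha g(X, Y)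

    is such that the (e, e) and (e, X) components of its covariant derivative
    vanish for every function alpha, and that its (X, Y) components vanish
    exactly when alpha satisfies the equation; so T is parallel
    ([cone_hess_parallel]).  The symmetry of DD alpha, i.e. the symmetry of
    second derivatives, enters here.

    Let mu and lambda be the minimum and the maximum of alpha on the compact
    manifold M.  Where alpha = mu, the form T - mu G vanishes against e, and on
    TM it is half the Hessian of alpha at a minimum, so it is positive
    semidefinite; in the same way lambda G - T is positive semidefinite where
    alpha = lambda ([cone_form_psd_extremum]).  Both forms are parallel, so both
    are positive semidefinite everywhere ([psd_everywhere]), and so is their sum
    (lambda - mu) G.  If mu < lambda, this makes g positive semidefinite, which a
    Lorentzian metric in dimension at least 2 is not.

    That positive semidefiniteness propagates along a segment in a chart
    ([parallel_psd]) is proved without solving the equation of parallel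
    transport.  Let F' = W F + F W^T on [0, 1], with F(0) positive semidefinite
    and W bounded, and minimise exp(- K t) v F(t) v^T over t in [0, 1] and unit
    v.  If the minimum is negative and attained at (t, v), then v is an
    eigenvector of F(t) for an eigenvalue l < 0, and t > 0.  The derivative in t
    there is exp(- K t) l (2 v W v^T - K), which is positive for K large, whereas
    at a minimum approached from the left it is at most 0.  Charts are related
    by the congruence of matrix diag(1, J), with J the Jacobian matrix
    ([cone_form_transition]), so the set of points where the form is positive
    semidefinite is well defined; it is open and closed, and M is connected.  *)

(** * Calculus in several variables *)

Lemma is_derive_line {R : realType} {V W : normedModType R} (f : V -> W)
    (y v : V) (t : R) :
  derivable f (y + t *: v) v ->
  is_derive t 1 (fun s : R => f (y + s *: v)) ('D_v f (y + t *: v)).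
Proof.
have E : (fun h : R => h^-1 *: (((fun s : R => f (y + s *: v)) \o shift t)
            (h *: (1 : R)) - f (y + t *: v))) =
    (fun h : R => h^-1 *: ((f \o shift (y + t *: v)) (h *: v) - f (y + t *: v))).
  apply/funext => h /=; congr (_ *: (f _ - _)).
  by rewrite [h%:A]mulr1 scalerDl addrCA.
by move=> df; split; rewrite /derivable /derive E.
Qed.

(** The sign of [s] is arbitrary, and derivability is only needed between [y]
    and [y + s *: v]. *)
Lemma MVT_line {R : realType} {V : normedModType R} (f : V -> R)
    (y v : V) (s : R) :
  (forall t : R, `|t| <= `|s| -> derivable f (y + t *: v) v) ->
  exists2 t, `|t| <= `|s| &
    f (y + s *: v) - f y = s * 'D_v f (y + t *: v).
Proof.
move=> df; pose g (t : R) := f (y + t *: v).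
pose dg (t : R) := 'D_v f (y + t *: v).
have dgP (t : R) : `|t| <= `|s| -> is_derive t 1 g (dg t).
  by move=> ts; exact/is_derive_line/df.
have gc (a b : R) : (forall t : R, t \in `[a, b] -> `|t| <= `|s|) ->
    {within `[a, b], continuous g}.
  move=> abs; apply: derivable_within_continuous => t tab.
  by have [] := dgP t (abs t tab).
have [s0|s0] := leP 0 s.
  have inn (t : R) : t \in `[0, s] -> `|t| <= `|s|.
    by rewrite in_itv /= => /andP[t0 ts]; rewrite !ger0_norm.
  have [||t ts] := @MVT_segment R g dg 0 s s0.
  - by move=> t ts; apply/dgP/inn/subset_itv_oo_cc.
  - exact: gc.
  rewrite subr0 /g scale0r addr0 => E; exists t; first exact: inn.
  by rewrite E mulrC.
have inn (t : R) : t \in `[s, 0] -> `|t| <= `|s|.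
  by rewrite in_itv /= => /andP[t0 ts]; rewrite !ler0_norm ?lerN2 // ltW.
have [||t ts] := @MVT_segment R g dg s 0 (ltW s0).
- by move=> t ts; apply/dgP/inn/subset_itv_oo_cc.
- exact: gc.
rewrite sub0r /g scale0r addr0 => E; exists t; first exact: inn.
by rewrite -opprB E mulrN opprK mulrC.
Qed.

Lemma normrV_le {R : realType} {n : nat} (v : 'rV[R]_n) (e : R) :
  0 <= e -> (forall j, `|v 0 j| <= e) -> `|v| <= e.
Proof.
move=> e0 H; rewrite [`|v|]mx_normrE; apply: bigmax_le => // -[i j] _ /=.
by rewrite ord1.
Qed.

Lemma normrV_coord {R : realType} {n : nat} (v : 'rV[R]_n) j : `|v 0 j| <= `|v|.
Proof.
by rewrite [`|v|]mx_normrE; apply: (le_bigmax _ (fun ij => `|v ij.1 ij.2|) (0, j)).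
Qed.

Lemma differentiable_near_linear {R : realType} {V W : normedModType R}
    (f : V -> W) (x : V) (df : {linear V -> W}) :
  continuous df ->
  (forall e : R, 0 < e ->
     \forall h \near (0 : V), `|f (h + x) - f x - df h| <= e * `|h|) ->
  differentiable f x.
Proof.
move=> cdf H.
have E : f \o shift x = cst (f x) + df +o_ 0 id.
  apply/eqaddoP => e e0; near=> h.
  by rewrite !fctE /= opprD addrA; near: h; exact: H.
by apply/diff_locallyP; rewrite (diff_unique cdf E).
Unshelve. all: by end_near. Qed.

Section C1.
Context {R : realType} {n : nat}.
Implicit Types (f : 'rV[R]_n -> R) (x : 'rV[R]_n).

(** Going from [x] to [h + x] one coordinate at a time. *)
Lemma telescope_coord f x (h : 'rV[R]_n) (r : R) :
  `|h| < r ->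
  (forall y : 'rV[R]_n, `|y - x| < r -> forall a, derivable f y (delta_mx 0 a)) ->
  exists2 xi : 'I_n -> 'rV[R]_n, (forall a, `|xi a - x| <= `|h|) &
    f (h + x) - f x = \sum_a h 0 a * partial_deriv a f (xi a).
Proof.
move=> hr df.
(* P k is x with its first k coordinates increased by those of h. *)
pose P (k : nat) : 'rV[R]_n := x + \row_j (if (j < k)%N then h 0 j else 0).
have PS (a : 'I_n) : P a.+1 = P a + h 0 a *: delta_mx 0 a.
  apply/rowP => j; rewrite !mxE ltnS leq_eqVlt eqxx /= -[j == a]/(val j == val a).
  by case: ltngtP => [_|_|ja]; rewrite ?mulr0 ?mulr1 ?addr0 ?add0r // (val_inj ja).
have Pin (a : 'I_n) (t : R) : `|t| <= `|h 0 a| ->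
    `|P a + t *: delta_mx 0 a - x| <= `|h|.
  move=> th; apply: normrV_le => // j.
  rewrite /P !mxE eqxx /= -[j == a]/(val j == val a).
  rewrite addrAC [x 0 j + _]addrC addrK.
  case: ltngtP => [_|_|_]; rewrite ?mulr0 ?mulr1 ?addr0 ?add0r ?normr0 //.
    exact: normrV_coord.
  exact/(le_trans th)/normrV_coord.
have step (a : 'I_n) : exists xi : 'rV[R]_n, `|xi - x| <= `|h| /\
    f (P a.+1) - f (P a) = h 0 a * partial_deriv a f xi.
  have [|t th E] := @MVT_line R _ f (P a) (delta_mx 0 a) (h 0 a).
    by move=> t th; apply: df; exact/le_lt_trans/hr/Pin.
  by exists (P a + t *: delta_mx 0 a); split; [exact: Pin | rewrite PS].
have [xi xiP] := choice step.
exists xi => [a|]; first by have [] := xiP a.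
transitivity (\sum_(a < n) (f (P a.+1) - f (P a))); last first.
  by apply: eq_bigr => a _; have [] := xiP a.
rewrite -(big_mkord xpredT (fun k => f (P k.+1) - f (P k))) telescope_sumr //.
congr (f _ - f _).
  by apply/rowP => j; rewrite !mxE ltn_ord addrC.
by apply/rowP => j; rewrite !mxE ltn0 addr0.
Qed.

(** Partial derivatives exist near [x] and are continuous at [x]. *)
Definition C1_at f x : Prop :=
  (\forall y \near x, forall a, derivable f y (delta_mx 0 a)) /\
  forall a, {for x, continuous (partial_deriv a f)}.

Lemma C1_differentiable f x : C1_at f x -> differentiable f x.
Proof.
move=> [df cf].
pose L (h : 'rV[R]_n) : R := \sum_a h 0 a * partial_deriv a f x.
have L_lin : linear L.
  move=> k u v; rewrite /L scaler_sumr -big_split /=; apply: eq_bigr => a _.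
  by rewrite !mxE mulrDl scalerAl.
pose LM := GRing.isLinear.Build _ _ _ _ _ L_lin.
pose LL : {linear 'rV[R]_n -> R} := HB.pack L LM.
have L_cont : continuous LL.
  move=> u; apply: differentiable_continuous.
  have -> : (LL : 'rV[R]_n -> R) =
      \sum_a (partial_deriv a f x *: (fun h : 'rV[R]_n => h 0 a)).
    apply/funext => h; rewrite fct_sumE; apply: eq_bigr => a _.
    by rewrite mulrC.
  by apply: differentiable_sum => a; apply/differentiableZ/differentiable_coord.
apply: (@differentiable_near_linear R 'rV[R]_n R f x LL L_cont) => _/posnumP[e].
have cfe : \forall y \near x, forall a,
    `|partial_deriv a f x - partial_deriv a f y| <= e%:num / n.+1%:R.
  apply: (@filter_forall _ _ _ (nbhs x)) => a.
  by have /cvgrPdist_le/(_ (e%:num / n.+1%:R)) := cf a; apply; rewrite divr_gt0.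
have /nbhs_normP[r r0 rP] : \forall y \near x,
    (forall a, derivable f y (delta_mx 0 a)) /\
    (forall a, `|partial_deriv a f x - partial_deriv a f y| <= e%:num / n.+1%:R).
  by near=> y; split; near: y.
have rP' y : `|y - x| < r -> _ :=
  fun yr => rP y (eq_ind _ (fun z => z < r) yr _ (distrC _ _)).
near=> h.
have hr : `|h| < r by near: h; exact: (@nbhs0_lt _ 'rV[R]_n r r0).
have [|xi xih Ef] := @telescope_coord f x h r hr.
  by move=> y yr; have [] := rP' y yr.
rewrite /= Ef /L -sumrB.
apply: le_trans (ler_norm_sum _ _ _) _.
have -> : e%:num * `|h| = \sum_(a < n.+1) (`|h| * (e%:num / n.+1%:R)).
  rewrite sumr_const card_ord -mulrnAr -[_ *+ n.+1]mulr_natr divfK ?pnatr_eq0 //.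
  by rewrite mulrC.
rewrite big_ord_recr /= -[leLHS]addr0 lerD //.
apply: ler_sum => a _; rewrite -mulrBr normrM ler_pM //.
  exact: normrV_coord.
rewrite distrC; have [_] := rP' (xi a) (le_lt_trans (xih a) hr); exact.
Unshelve. all: by end_near. Qed.

Lemma derive_coordE {W : normedModType R} (f : 'rV[R]_n -> W) x v :
  differentiable f x -> 'D_v f x = \sum_a v 0 a *: partial_deriv a f x.
Proof.
move=> df; rewrite deriveE // [X in 'd f x X]row_sum_delta linear_sum /=.
by apply: eq_bigr => a _; rewrite linearZ /= /partial_deriv deriveE.
Qed.

End C1.

Lemma eq_of_close {R : realFieldType} (A B : R) :
  (forall e, 0 < e -> exists2 C, `|A - C| <= e & `|B - C| <= e) -> A = B.
Proof.
move=> H; apply/eqP/contraT; rewrite -subr_eq0 -normr_gt0 => d0.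
have [|C AC BC] := H (`|A - B| / 4); first by rewrite divr_gt0.
have := ler_normD (A - C) (C - B); rewrite subrKA [`|C - B|]distrC.
move: d0 AC BC; move: `|A - B| `|A - C| `|B - C| => d a b; lra.
Qed.

Section Schwarz.
Context {R : realType} {V : normedModType R}.
Implicit Types (f : V -> R) (x u v : V).

Lemma derive_translate f (c y v : V) :
  'D_v (fun z => f (z + c)) y = 'D_v f (y + c).
Proof. by rewrite /derive; under eq_fun => h do rewrite /= -addrA. Qed.

Lemma derivable_translate f (c y v : V) :
  derivable f (y + c) v -> derivable (fun z => f (z + c)) y v.
Proof. by rewrite /derivable; under [in X in _ -> X]eq_fun => h do rewrite /= -addrA. Qed.

(** The mean value theorem applied to [f (y + s *: v) - f y] along [u], then
    to ['D_u f] along [v]. *)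
Lemma second_difference f x u v (s r : R) :
  `|s| * (`|u| + `|v|) < r ->
  (forall y : V, `|y - x| < r -> derivable f y u /\ derivable ('D_u f) y v) ->
  exists2 xi : V, `|xi - x| < r &
    f (x + s *: u + s *: v) - f (x + s *: u) - (f (x + s *: v) - f x) =
    s * (s * 'D_v ('D_u f) xi).
Proof.
move=> sr df.
have nearx (t t' : R) : `|t| <= `|s| -> `|t'| <= `|s| ->
    `|x + t *: u + t' *: v - x| < r.
  move=> ts ts'; apply: le_lt_trans sr; rewrite addrC !addrA addNr add0r mulrDr.
  by apply: le_trans (ler_normD _ _) _; rewrite lerD // normrZ ler_wpM2r.
have s0 : `|0 : R| <= `|s| by rewrite normr0.
have d1 (t t' : R) (ts : `|t| <= `|s|) (ts' : `|t'| <= `|s|) :=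
  df _ (nearx t t' ts ts').
have d1' (t : R) (ts : `|t| <= `|s|) : derivable f (x + t *: u) u.
  by have [] := d1 t 0 ts s0; rewrite scale0r addr0.
pose g y := f (y + s *: v) - f y.
have [t ts|t ts Eg] := @MVT_line R V g x u s.
  by apply: derivableB; [apply/derivable_translate/(d1 t s ts _).1 | exact: d1'].
have {}Eg : g (x + s *: u) - g x =
    s * ('D_u f (x + t *: u + s *: v) - 'D_u f (x + t *: u)).
  rewrite Eg deriveB ?derive_translate //; last exact: d1'.
  exact/derivable_translate/(d1 t s ts _).1.
have [t' ts'|t' ts' Ef] := @MVT_line R V ('D_u f) (x + t *: u) v s.
  exact: (d1 t t' ts ts').2.
by exists (x + t *: u + t' *: v); [exact: nearx | rewrite -Ef -Eg].
Qed.

(** Symmetry of second derivatives: the second difference of [f] is symmetric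
    in [u] and [v], and is close to [s ^+ 2] times each of the two mixed
    derivatives at [x]. *)
Lemma derive_derive_sym f x u v :
  (\forall y \near x, [/\ derivable f y u, derivable f y v,
     derivable ('D_u f) y v & derivable ('D_v f) y u]) ->
  {for x, continuous ('D_v ('D_u f))} -> {for x, continuous ('D_u ('D_v f))} ->
  'D_v ('D_u f) x = 'D_u ('D_v f) x.
Proof.
move=> df cvu cuv; apply: eq_of_close => e e0.
have /nbhs_normP[r r0 rP] : \forall y \near x,
    [/\ derivable f y u, derivable f y v,
      derivable ('D_u f) y v & derivable ('D_v f) y u] /\
    (`|'D_v ('D_u f) x - 'D_v ('D_u f) y| <= e /\
     `|'D_u ('D_v f) x - 'D_u ('D_v f) y| <= e).
  move/cvgrPdist_le : cvu => /(_ _ e0) cvu.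
  move/cvgrPdist_le : cuv => /(_ _ e0) cuv.
  exact: filterI df (filterI cvu cuv).
have {}rP (y : V) : `|y - x| < r -> _ :=
  fun yr => rP y (eq_ind _ (fun z => z < r) yr _ (distrC _ _)).
(* The added 1 covers the case where u and v both vanish. *)
pose s := r / (`|u| + `|v| + 1).
have den : 0 < `|u| + `|v| + 1 by rewrite ltr_wpDl // addr_ge0.
have s0 : 0 < s by rewrite divr_gt0.
have sr : `|s| * (`|u| + `|v|) < r.
  rewrite gtr0_norm // -[ltRHS](divfK (lt0r_neq0 den)) -/s.
  by rewrite ltr_pM2l // ltrDl.
have [y yr|y yr Ey] := second_difference f x u v s r sr.
  by have [[]] := rP y yr.
rewrite addrC in sr.
have [z zr|z zr Ez] := second_difference f x v u s r sr.
  by have [[]] := rP z zr.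
have E : 'D_v ('D_u f) y = 'D_u ('D_v f) z.
  apply: (mulfI (lt0r_neq0 s0)); apply: (mulfI (lt0r_neq0 s0)).
  apply: (etrans (esym Ey)); apply: (etrans _ Ez).
  rewrite [x + s *: v + s *: u]addrAC.
  by move: (f _) (f (x + s *: u)) (f _) (f _) => k1 k2 k3 k4; ring.
have [_ [b1 _]] := rP y yr; have [_ [_ b2]] := rP z zr.
by exists ('D_v ('D_u f) y); [exact: b1 | rewrite E; exact: b2].
Qed.

End Schwarz.

Section Smooth.
#[local] Set Implicit Arguments.
#[local] Unset Strict Implicit.
Context {R : realType} {n : nat}.
Implicit Types (U : set 'rV[R]_n) (x : 'rV[R]_n).

Lemma smooth_partial {W : normedModType R} U (f : 'rV[R]_n -> W) a :
  smooth_on U f -> smooth_on U (partial_deriv a f).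
Proof.
by move=> sf s x Ux; have := sf (rcons s a) x Ux; rewrite /iter_partial foldr_rcons.
Qed.

Lemma smooth_continuous {W : normedModType R} U (f : 'rV[R]_n -> W) x :
  smooth_on U f -> U x -> {for x, continuous f}.
Proof. by move=> sf Ux; have [] := sf [::] x Ux. Qed.

Lemma smooth_derivable {W : normedModType R} U (f : 'rV[R]_n -> W) x a :
  smooth_on U f -> U x -> derivable f x (delta_mx 0 a).
Proof. by move=> sf Ux; have [_] := sf [::] x Ux; apply. Qed.

Lemma open_near {T : topologicalType} (U : set T) (x : T) (P : T -> Prop) :
  open U -> U x -> (forall y, U y -> P y) -> \forall y \near x, P y.
Proof. by move=> oU Ux UP; apply: filterS UP _; exact: open_nbhs_nbhs. Qed.

Lemma near_eq_continuous {T T' : topologicalType} (f g : T -> T') (y : T) :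
  (\forall z \near y, f z = g z) ->
  {for y, continuous f} -> {for y, continuous g}.
Proof.
move=> E; rewrite /prop_for /continuous_at (nbhs_singleton E) => C.
by apply: cvg_trans C; apply: near_eq_cvg.
Qed.

Lemma smooth_differentiable U (f : 'rV[R]_n -> R) x :
  open U -> smooth_on U f -> U x -> differentiable f x.
Proof.
move=> oU sf Ux; apply: C1_differentiable; split.
  by apply: open_near oU Ux _ => y Uy a; exact: smooth_derivable sf Uy.
by move=> a; exact: smooth_continuous (smooth_partial a sf) Ux.
Qed.

Lemma derive_entry {V : normedModType R} {p q} (F : V -> 'M[R]_(p, q)) (y v : V) i j :
  derivable F y v -> 'D_v (fun z => F z i j) y = ('D_v F y) i j.
Proof. by move=> dF; rewrite derive_mx // mxE. Qed.

Lemma smooth_differentiable_entry {p q} U (F : 'rV[R]_n -> 'M[R]_(p, q)) x i j :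
  open U -> smooth_on U F -> U x -> differentiable (fun y => F y i j) x.
Proof.
move=> oU sF Ux; apply: C1_differentiable; split.
  apply: open_near oU Ux _ => y Uy a.
  exact: (derivable_mxP F y (delta_mx 0 a)).1 (smooth_derivable sF Uy) i j.
move=> a.
have E : \forall y \near x,
    partial_deriv a F y i j = partial_deriv a (fun z => F z i j) y.
  apply: open_near oU Ux _ => y Uy.
  by rewrite [RHS]derive_entry //; exact: smooth_derivable sF Uy.
have C : {for x, continuous (fun y => partial_deriv a F y i j)}.
  apply: (@continuous_comp _ _ _ (partial_deriv a F)
            (fun N : 'M[R]_(p, q) => N i j) x); last exact: coord_continuous.
  exact: (smooth_continuous (smooth_partial a sF) Ux).
exact: near_eq_continuous E C.
Qed.

Lemma differentiable_mx {V : normedModType R} {p q} (F : V -> 'M[R]_(p, q)) (x : V) :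
  (forall i j, differentiable (fun y => F y i j) x) -> differentiable F x.
Proof.
move=> dF.
have -> : F = \sum_i \sum_j (fun y => F y i j *: delta_mx i j).
  apply/funext => y; rewrite [LHS]matrix_sum_delta fct_sumE.
  by apply: eq_bigr => i _; rewrite fct_sumE.
apply: differentiable_sum => i; apply: differentiable_sum => j.
exact: differentiableZl.
Qed.

Lemma smooth_differentiable_mx {p q} U (F : 'rV[R]_n -> 'M[R]_(p, q)) x :
  open U -> smooth_on U F -> U x -> differentiable F x.
Proof.
move=> oU sF Ux; apply: differentiable_mx => i j.
exact: smooth_differentiable_entry sF Ux.
Qed.

Lemma smooth_partialC U (f : 'rV[R]_n -> R) x a b :
  open U -> smooth_on U f -> U x ->
  partial_deriv a (partial_deriv b f) x = partial_deriv b (partial_deriv a f) x.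
Proof.
move=> oU sf Ux; apply: derive_derive_sym.
- apply: open_near oU Ux _ => y Uy; split.
  + exact: smooth_derivable sf Uy.
  + exact: smooth_derivable sf Uy.
  + exact: smooth_derivable (smooth_partial b sf) Uy.
  + exact: smooth_derivable (smooth_partial a sf) Uy.
- exact: smooth_continuous (smooth_partial a (smooth_partial b sf)) Ux.
- exact: smooth_continuous (smooth_partial b (smooth_partial a sf)) Ux.
Qed.

Lemma jacobianE {m} (tau : 'rV[R]_n -> 'rV[R]_m) x a c :
  differentiable tau x -> 'J tau x a c = partial_deriv a tau x 0 c.
Proof. by move=> dtau; rewrite /partial_deriv deriveEjacobian // -rowE [RHS]mxE. Qed.

Lemma partial_comp {m} (tau : 'rV[R]_n -> 'rV[R]_m) (f : 'rV[R]_m -> R) x a :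
  differentiable tau x -> differentiable f (tau x) ->
  partial_deriv a (f \o tau) x = \sum_c 'J tau x a c * partial_deriv c f (tau x).
Proof.
move=> dtau df.
rewrite {1}/partial_deriv deriveE; last exact: differentiable_comp.
rewrite diff_comp //= -!deriveE // derive_coordE //.
by apply: eq_bigr => c _; rewrite jacobianE.
Qed.

Lemma near_line {V : normedModType R} (x w : V) (P : V -> Prop) :
  (\forall y \near x, P y) -> \forall t \near (0 : R), P (x + t *: w).
Proof.
have c : (fun t : R => x + t *: w) @ (0 : R) --> x.
  rewrite -[X in _ --> X]addr0 -[X in _ + X](scale0r w).
  by apply: cvgD; [exact: cvg_cst | exact: scalel_continuous].
exact: c.
Qed.

Lemma is_derive_partial (f : 'rV[R]_n -> R) (x : 'rV[R]_n) a :
  differentiable f x -> is_derive x (delta_mx 0 a) f (partial_deriv a f x).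
Proof. by move=> df; apply: derivableP; exact: diff_derivable. Qed.

Lemma is_derive_mulfl (V : normedModType R) (f : V -> R) (x v : V) (k df : R) :
  is_derive x v f df -> is_derive x v (fun y => k * f y) (k * df).
Proof. by move=> H; exact: is_deriveZ. Qed.

Lemma is_derive_mulf (V : normedModType R) (f h : V -> R) (x v : V) (df dh : R) :
  is_derive x v f df -> is_derive x v h dh ->
  is_derive x v (fun y => f y * h y) (f x * dh + h x * df).
Proof. by move=> Hf Hh; exact: is_deriveM. Qed.

Lemma is_derive_addf (V : normedModType R) (f h : V -> R) (x v : V) (df dh : R) :
  is_derive x v f df -> is_derive x v h dh ->
  is_derive x v (fun y => f y + h y) (df + dh).
Proof. by move=> Hf Hh; exact: is_deriveD. Qed.

Lemma differentiable_mulfl (V : normedModType R) (f : V -> R) (x : V) (k : R) :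
  differentiable f x -> differentiable (fun y => k * f y) x.
Proof. by move=> df; exact: differentiableZ. Qed.

Lemma derivable_bounded_unit (f : R -> R) :
  (forall t : R, 0 <= t <= 1 -> derivable f t 1) ->
  exists B, forall t : R, 0 <= t <= 1 -> `|f t| <= B.
Proof.
move=> df; have fc : {within `[0, 1], continuous f}.
  by apply: derivable_within_continuous => t; rewrite in_itv /=; exact: df.
have [c1 _ c1P] := EVT_max ler01 fc; have [c2 _ c2P] := EVT_min ler01 fc.
exists (`|f c1| + `|f c2|) => t t01.
have tin : t \in `[0, 1] by rewrite in_itv.
move: (c1P t tin) (c2P t tin) (ler_norm (f c1)) (ler_norm (- f c2)).
rewrite normrN ler_norml => h1 h2 h3 h4.
have h5 := normr_ge0 (f c1); have h6 := normr_ge0 (f c2).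
by apply/andP; split; lra.
Qed.

Lemma sum_delta (f : 'I_n -> R) a : \sum_k (delta_mx 0 a : 'rV[R]_n) 0 k * f k = f a.
Proof.
rewrite (bigD1 a) //= mxE !eqxx mul1r big1 ?addr0 // => k ka.
by rewrite mxE (negbTE ka) andbF mul0r.
Qed.

End Smooth.

(** * One-variable minimum tests *)

Section OneVariable.
Context {R : realType}.
Implicit Types (f g : R -> R) (a b c L : R).
#[local] Set Implicit Arguments.
#[local] Unset Strict Implicit.

(** Only the values of [f] to the left of [b] are compared with [f b]. *)
Lemma is_derive_left_min f a b L :
  a < b -> is_derive b 1 f L -> (forall t, a <= t <= b -> f b <= f t) -> L <= 0.
Proof.
move=> ab [df <-] fmin; rewrite leNgt; apply/negP => L0.
have [e /= e0 eP] : \forall h \near (0 : R)^',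
    0 < h^-1 *: (f (h *: 1 + b) - f b) by exact: cvgr_gt df _ L0.
pose h := Num.min (e / 2) (b - a).
have h0 : 0 < h by rewrite lt_min divr_gt0 //= subr_gt0.
have /eP : ball_ (fun z : R => `|z|) 0 e (- h).
  by rewrite /= sub0r opprK gtr0_norm // gt_min ltr_pdivrMr // ltr_pMr // ltr1n.
rewrite oppr_eq0 (lt0r_neq0 h0) => /(_ isT).
rewrite invrN [(- h)%:A]mulr1 [_ *: _]mulNr oppr_gt0 pmulr_rlt0 ?invr_gt0 //.
rewrite subr_lt0 ltNge fmin // [- h + b]addrC lerBrDr -lerBrDl ge_min lexx orbT /=.
by rewrite gerDl oppr_le0 ltW.
Qed.

Lemma second_derivative_min f g L :
  (\forall t \near (0 : R), is_derive t (1 : R) f (g t)) -> is_derive (0 : R) 1 g L ->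
  (\forall t \near (0 : R), f 0 <= f t) ->
  g 0 = 0 /\ 0 <= L.
Proof.
move=> df dg fmin.
have [e /= e0 eP] : \forall t \near (0 : R),
    is_derive t (1 : R) f (g t) /\ f 0 <= f t by exact: filterI df fmin.
have inb (t : R) : t \in `]-e, e[ -> ball_ (fun z : R => `|z|) 0 e t.
  by rewrite in_itv /= sub0r normrN ltr_norml.
have g0 : g 0 = 0.
  have f0 : is_derive (0 : R) 1 f 0.
    apply: (@derive1_at_min R f (- e) e).
    - by apply: ltW; lra.
    - by move=> t /inb/eP[[]].
    - by rewrite in_itv /= oppr_lt0 e0.
    - by move=> t /inb/eP[].
  have [f0' _] := eP 0 (inb 0 ltac:(by rewrite in_itv /= oppr_lt0 e0)).
  by case: f0' => _ <-; case: f0.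
split=> //; rewrite leNgt; apply/negP => L0; case: dg => dg Lg.
rewrite -Lg in L0.
have [d /= d0 dP] : \forall h \near (0 : R)^',
    h^-1 *: (g (h *: 1 + 0) - g 0) < 0 by exact: cvgr_lt dg _ L0.
pose s := Num.min e d / 2.
have m0 : 0 < Num.min e d by rewrite lt_min e0.
have s0 : 0 < s by rewrite divr_gt0.
have sm : s < Num.min e d by rewrite ltr_pdivrMr // ltr_pMr // ltr1n.
have [se sd] : s < e /\ s < d by move: sm; rewrite lt_min => /andP.
have inn (t : R) : t \in `[0, s] -> ball_ (fun z : R => `|z|) 0 e t.
  rewrite in_itv /= => /andP[t0 ts]; rewrite sub0r normrN ger0_norm //.
  exact: le_lt_trans se.
have [||c cs] := @MVT R f g 0 s s0.
- by move=> t ts; have [] := eP t (inn t (subset_itv_oo_cc ts)).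
- apply: derivable_within_continuous => t ts.
  by have [[]] := eP t (inn t ts).
have := cs; rewrite in_itv /= => /andP[c0 cs'].
have gc : g c < 0.
  have /dP : ball_ (fun z : R => `|z|) 0 d c.
    by rewrite /= sub0r normrN gtr0_norm // (lt_trans cs').
  rewrite (lt0r_neq0 c0) => /(_ isT).
  by rewrite [c%:A]mulr1 addr0 g0 subr0 pmulr_rlt0 ?invr_gt0.
have [_ fs] := eP s (inn s ltac:(by rewrite in_itv /= lexx ltW)).
move=> E; have : 0 <= f s - f 0 by rewrite subr_ge0.
by rewrite E subr0 pmulr_lge0 // leNgt gc.
Qed.

End OneVariable.

(** * Positive semidefinite matrices *)

Section QuadraticForm.
Context {R : realType}.
#[local] Set Implicit Arguments.
#[local] Unset Strict Implicit.

(** The value at the row vector [v] of the quadratic form of matrix [M]. *)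
Definition qform {m} (M : 'M[R]_m) (v : 'rV[R]_m) : R := (v *m M *m v^T) 0 0.

(** Positive semidefiniteness; the matrix is not required to be symmetric. *)
Definition psd {m} (M : 'M[R]_m) : Prop := forall v, 0 <= qform M v.

Lemma qformE {m} (M : 'M[R]_m) v :
  qform M v = \sum_i \sum_j v 0 i * M i j * v 0 j.
Proof.
rewrite /qform mxE exchange_big /=; apply: eq_bigr => j _.
by rewrite !mxE big_distrl.
Qed.

Lemma qformD {m} (M N : 'M[R]_m) v : qform (M + N) v = qform M v + qform N v.
Proof. by rewrite /qform mulmxDr mulmxDl mxE. Qed.

Lemma qformZ {m} a (M : 'M[R]_m) v : qform (a *: M) v = a * qform M v.
Proof. by rewrite /qform -scalemxAr -scalemxAl mxE. Qed.

Lemma qformZv {m} a (M : 'M[R]_m) v : qform M (a *: v) = a ^+ 2 * qform M v.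
Proof. by rewrite /qform linearZ /= -!scalemxAl -scalemxAr !mxE mulrA. Qed.

Lemma qform_tr {m} (M : 'M[R]_m) v : qform M^T v = qform M v.
Proof.
have -> : qform M v = (v *m M *m v^T)^T 0 0 by rewrite mxE.
by rewrite !trmx_mul trmxK mulmxA.
Qed.

Lemma qform_congr {m k} (A : 'M[R]_(k, m)) (M : 'M[R]_m) v :
  qform (A *m M *m A^T) v = qform M (v *m A).
Proof. by rewrite /qform trmx_mul !mulmxA. Qed.

Lemma psd_congr {m k} (A : 'M[R]_(k, m)) (M : 'M[R]_m) :
  psd M -> psd (A *m M *m A^T).
Proof. by move=> pM v; rewrite qform_congr. Qed.

Lemma qform1_ge0 {m} (v : 'rV[R]_m) : 0 <= qform 1%:M v.
Proof.
rewrite /qform mulmx1 mxE sumr_ge0 // => i _.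
by rewrite mxE -expr2 sqr_ge0.
Qed.

Lemma qform1_eq0 {m} (v : 'rV[R]_m) : (qform 1%:M v == 0) = (v == 0).
Proof.
rewrite /qform mulmx1 mxE psumr_eq0 => [|i _]; last by rewrite mxE -expr2 sqr_ge0.
apply/idP/eqP => [/allP v0|->].
  apply/rowP => i; have /implyP/(_ isT) := v0 i (mem_index_enum i).
  by rewrite !mxE mulf_eq0 orbb => /eqP.
by apply/allP => i _; rewrite !mxE mulr0 eqxx.
Qed.

Lemma coord_le_qform1 {m} (v : 'rV[R]_m) i : qform 1%:M v = 1 -> `|v 0 i| <= 1.
Proof.
rewrite /qform mulmx1 mxE (bigD1 i) //= mxE -expr2 => E.
rewrite -(@expr_le1 _ 2) // real_normK ?num_real // -E lerDl.
by rewrite sumr_ge0 // => j _; rewrite mxE -expr2 sqr_ge0.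
Qed.

Lemma qform_addZ {m} (M : 'M[R]_m) v w t : M^T = M ->
  qform M (v + t *: w) =
  qform M v + t * (2 * (v *m M *m w^T) 0 0) + t ^+ 2 * qform M w.
Proof.
move=> sM; have E : (w *m M *m v^T) 0 0 = (v *m M *m w^T) 0 0.
  have -> : (v *m M *m w^T) 0 0 = (v *m M *m w^T)^T 0 0 by rewrite [RHS]mxE.
  by rewrite !trmx_mul trmxK sM mulmxA.
rewrite /qform linearD linearZ /= !mulmxDl !mulmxDr -!scalemxAl -!scalemxAr.
have eD (A B : 'M[R]_1) : (A + B) 0 0 = A 0 0 + B 0 0 by rewrite mxE.
have eZ a (A : 'M[R]_1) : (a *: A) 0 0 = a * A 0 0 by rewrite mxE.
rewrite !(eD, eZ) E; ring.
Qed.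

(** A null vector of a positive semidefinite form lies in its kernel. *)
Lemma psd_kernel {m} (M : 'M[R]_m) v : M^T = M -> psd M -> qform M v = 0 ->
  v *m M = 0.
Proof.
move=> sM pM v0; apply/eqP; rewrite -qform1_eq0.
set w := v *m M; set b := qform 1%:M w; set c := qform M w.
have bE : (v *m M *m w^T) 0 0 = b by rewrite /b /qform mulmx1.
have c0 : 0 <= c := pM w.
have H t : 0 <= t * (2 * b) + t ^+ 2 * c.
  by have := pM (v + t *: w); rewrite qform_addZ // v0 add0r bE.
have b0 : 0 <= b := qform1_ge0 w.
(* H bounds below a quadratic polynomial without constant term; this value
   of t makes it negative unless b = 0, and is defined also when c = 0. *)
have := H (- (b / (c + 1))).
have c1 : c + 1 != 0 by rewrite lt0r_neq0 // ltr_wpDl.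
have -> : - (b / (c + 1)) * (2 * b) + (- (b / (c + 1))) ^+ 2 * c =
   - (b ^+ 2 * ((c + 2) / (c + 1) ^+ 2)) by field.
rewrite oppr_ge0 pmulr_lle0 ?divr_gt0 ?exprn_gt0 ?ltr_wpDl //.
by rewrite le_eqVlt ltNge sqr_ge0 orbF sqrf_eq0.
Qed.

(** A vector at which the quotient of a quadratic form by the squared Euclidean
    norm attains its minimum [l] is an eigenvector for [l]. *)
Lemma eigen_of_min {m} (M : 'M[R]_m) v (l : R) : M^T = M ->
  (forall w, l * qform 1%:M w <= qform M w) -> qform M v = l * qform 1%:M v ->
  v *m M = l *: v.
Proof.
move=> sM lM vM; apply/eqP; rewrite -subr_eq0 -mul_mx_scalar -mulmxBr; apply/eqP.
apply: psd_kernel.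
- by rewrite linearB /= sM tr_scalar_mx.
- move=> w; rewrite -scalemx1 -scaleNr qformD qformZ mulNr subr_ge0; exact: lM.
- by rewrite -scalemx1 -scaleNr qformD qformZ mulNr vM subrr.
Qed.

End QuadraticForm.

(** * Parallel families of symmetric matrices *)

Section ParallelForm.
Context {R : realType} {m : nat}.
#[local] Set Implicit Arguments.
#[local] Unset Strict Implicit.

Lemma cvg_sumr {T : Type} (F : set_system T) {FF : Filter F} (k : nat)
    (f : 'I_k -> T -> R) (l : 'I_k -> R) :
  (forall i, f i x @[x --> F] --> l i) ->
  \sum_i f i x @[x --> F] --> \sum_i l i.
Proof.
by move=> fl; apply: (@cvg_big _ _ _ _ xpredT (@add_continuous R)) => i _.
Qed.

Lemma is_derive_expRM (k t : R) :
  is_derive t (1 : R) (fun s => expR (k * s)) (k * expR (k * t)).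
Proof.
have dk : is_derive t (1 : R) (fun s : R => k * s) k.
  have -> : (fun s : R => k * s) = k \*: (id : R -> R) by apply/funext.
  by apply: is_derive_eq; rewrite [LHS]mulr1.
have de : derivable (expR : R -> R) (k * t) 1 by [].
case: dk => dk Dk; split.
  apply/derivable1_diffP.
  apply: (@differentiable_comp _ _ _ _ (fun s : R => k * s) expR).
    exact: (derivable1_diffP _ _).1 dk.
  exact: (derivable1_diffP _ _).1 de.
have := @derive1_comp R (fun s : R => k * s) expR t dk de.
by rewrite !derive1E Dk => ->; rewrite derive_val mulrC.
Qed.

Lemma unit_sphere_compact : compact [set v : 'rV[R]_m | qform 1%:M v = 1].
Proof.
apply: bounded_closed_compact.
  exists 1; split; first exact: num_real.
  move=> M M1 v /= v1; apply: le_trans (ltW M1).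
  by apply: normrV_le => // j; exact: coord_le_qform1.
have C : continuous (fun v : 'rV[R]_m => qform 1%:M v).
  have -> : (fun v : 'rV[R]_m => qform 1%:M v) =
            (fun v : 'rV[R]_m => \sum_j v 0 j * v 0 j).
    apply/funext => v; rewrite /qform mulmx1 mxE.
    by apply: eq_bigr => j _; rewrite mxE.
  move=> v; apply: (@cvg_sumr _ _ (nbhs_filter v)) => j.
  by apply: cvgM; exact: coord_continuous.
rewrite (_ : [set _ | _] = (fun v => qform 1%:M v) @^-1` [set 1]) //.
by apply: preimage_closed => //; exact: closed_eq.
Qed.

Lemma qform_normalize (M : 'M[R]_m) v : qform M v < 0 ->
  exists2 w, qform 1%:M w = 1 & qform M w < 0.
Proof.
move=> Mv; have v1 : 0 < qform 1%:M v.
  rewrite lt0r qform1_ge0 qform1_eq0 andbT; apply: contraTneq Mv => ->.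
  by rewrite /qform !mul0mx mxE ltxx.
exists ((Num.sqrt (qform 1%:M v))^-1 *: v).
  by rewrite qformZv exprVn sqr_sqrtr ?ltW // mulVf // lt0r_neq0.
by rewrite qformZv pmulr_rlt0 // exprn_gt0 // invr_gt0 sqrtr_gt0.
Qed.

(** A symmetric solution of F' = Om F + F Om^T that is positive semidefinite at
    time 0 is so at time 1. *)
Lemma parallel_psd (F Om : R -> 'M[R]_m) (B : R) :
  (forall t : R, 0 <= t <= 1 -> forall i j,
     is_derive t (1 : R) (fun s => F s i j)
       ((Om t *m F t + F t *m (Om t)^T) i j)) ->
  (forall t : R, 0 <= t <= 1 -> (F t)^T = F t) ->
  (forall t : R, 0 <= t <= 1 -> forall i j, `|Om t i j| <= B) ->
  psd (F 0) -> psd (F 1).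
Proof.
move=> dF sF OmB F0 v; rewrite leNgt; apply/negP => /qform_normalize[w w1 Fw].
pose S : set 'rV[R]_m := [set v | qform 1%:M v = 1].
pose A : set (R * 'rV[R]_m) := `[0, 1]%classic `*` S.
(* Twice the quadratic form of Om t is less than K on the unit sphere. *)
pose K : R := 2 * (\sum_(i < m) \sum_(j < m) B) + 1.
pose h (p : R * 'rV[R]_m) : R := expR (- K * p.1) * qform (F p.1) p.2.
have hc : {within A, continuous h}.
  apply: continuous_in_subspaceT => -[t u] /set_mem[/= tin _].
  rewrite /h; apply: cvgM.
    apply: (@cvg_comp _ _ _ (fun p : R * 'rV[R]_m => - K * p.1) expR
              _ (nbhs (- K * t))).
      by apply: cvgM; [exact: cvg_cst | exact: cvg_fst].
    exact: continuous_expR.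
  under eq_fun => p do rewrite qformE.
  rewrite qformE; apply: (@cvg_sumr _ _ (nbhs_filter (t, u))) => i.
  apply: (@cvg_sumr _ _ (nbhs_filter (t, u))) => j.
  have cu (k : 'I_m) : (p.2 : 'rV[R]_m) 0 k @[p --> (t, u)] --> u 0 k.
    apply: (@cvg_comp _ _ _ (@snd R 'rV[R]_m) (fun N : 'rV[R]_m => N 0 k)
              _ (nbhs u)); [exact: cvg_snd | exact: coord_continuous].
  apply: cvgM (cu j); apply: cvgM (cu i) _.
  apply: (@cvg_comp _ _ _ (@fst R 'rV[R]_m) (fun s => F s i j) _ (nbhs t)).
    exact: cvg_fst.
  have cF : {for t, continuous (fun s => F s i j)}.
    apply: differentiable_continuous; apply/derivable1_diffP.
    by have [] := dF t tin i j.
  exact: cF.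
have A0 : A !=set0 by exists (1, w); split=> //=; rewrite in_itv /= lexx ler01.
have Ac : compact A.
  by apply: compact_setX; [exact: segment_compact | exact: unit_sphere_compact].
have [[t u] /set_mem[/= tin u1] hmin] := compact_EVT_min A0 Ac hc.
rewrite in_itv /= in tin.
set l := qform (F t) u.
have l0 : l < 0.
  have : h (t, u) < 0.
    apply: le_lt_trans (hmin (1, w) _) _.
      by apply/mem_set; split=> //=; rewrite in_itv /= lexx ler01.
    by rewrite /h /= pmulr_rlt0 // expR_gt0.
  by rewrite /h /= pmulr_rlt0 // expR_gt0.
have lmin z : l * qform 1%:M z <= qform (F t) z.
  have [z0|z0] := eqVneq z 0.
    by rewrite z0 /qform !mul0mx mxE mulr0.
  have z1 : 0 < qform 1%:M z by rewrite lt0r qform1_eq0 z0 qform1_ge0.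
  pose y := (Num.sqrt (qform 1%:M z))^-1 *: z.
  have y1 : qform 1%:M y = 1.
    by rewrite qformZv exprVn sqr_sqrtr ?ltW // mulVf // lt0r_neq0.
  have : h (t, u) <= h (t, y).
    by apply: hmin; apply/mem_set; split => //=; rewrite in_itv.
  rewrite /h /= ler_pM2l ?expR_gt0 // -/l qformZv exprVn sqr_sqrtr ?(ltW z1) //.
  by rewrite ler_pdivlMl // [l * _]mulrC.
(* The minimum over the sphere makes u an eigenvector, which gives the
   derivative of the quadratic form at u in terms of l alone. *)
have uF : u *m F t = l *: u.
  by apply: eigen_of_min => //; [exact: sF | rewrite u1 mulr1].
have t0 : 0 < t.
  have /andP[t0 _] := tin; rewrite lt0r t0 andbT.
  by apply: contraTneq l0 => t00; rewrite /l t00 -leNgt F0.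
have dq : is_derive t (1 : R) (fun s => qform (F s) u) (l * (2 * qform (Om t) u)).
  have E : l * (2 * qform (Om t) u) =
      \sum_i \sum_j u 0 i * (Om t *m F t + F t *m (Om t)^T) i j * u 0 j.
    rewrite -qformE qformD.
    have -> : qform (Om t *m F t) u = l * qform (Om t) u.
      rewrite -qform_tr trmx_mul sF // /qform mulmxA uF -!scalemxAl mxE.
      by congr (_ * _); exact: qform_tr.
    have -> : qform (F t *m (Om t)^T) u = l * qform (Om t) u.
      rewrite /qform mulmxA uF -!scalemxAl mxE.
      by congr (_ * _); exact: qform_tr.
    ring.
  rewrite E; have -> : (fun s => qform (F s) u) =
      \sum_i \sum_j (fun s => u 0 i * F s i j * u 0 j).
    apply/funext => s; rewrite qformE fct_sumE; apply: eq_bigr => i _.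
    by rewrite fct_sumE.
  apply: is_derive_sum => i; apply: is_derive_sum => j.
  have dFij := dF t tin i j.
  have -> : (fun s => u 0 i * F s i j * u 0 j) =
      (u 0 i * u 0 j) \*: (fun s => F s i j).
    by apply/funext => s /=; rewrite mulrAC.
  by apply: is_derive_eq; rewrite mulrAC.
have dh : is_derive t (1 : R) (fun s => h (s, u))
    (expR (- K * t) * (l * (2 * qform (Om t) u - K))).
  have := is_deriveM (is_derive_expRM (- K) t) dq.
  rewrite /h /= => dM; apply: is_derive_eq dM _.
  rewrite /GRing.scale /= -/l; ring.
have h0 : expR (- K * t) * (l * (2 * qform (Om t) u - K)) <= 0.
  apply: (is_derive_left_min t0 dh) => s /andP[s0 st]; apply: hmin.
  apply/mem_set; split => //=; rewrite in_itv /= s0 (le_trans st) //.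
  by case/andP: tin.
move: h0; rewrite pmulr_rle0 ?expR_gt0 // nmulr_rle0 // subr_ge0 leNgt => /negP; apply.
rewrite /K ltr_pwDr // ler_pM2l // qformE; apply: ler_sum => i _; apply: ler_sum => j _.
apply: le_trans (ler_norm _) _; rewrite !normrM -[leRHS]mulr1 -[X in _ <= X * _]mul1r.
rewrite ler_pM ?mulr_ge0 //; last exact: coord_le_qform1.
by rewrite ler_pM //; [exact: coord_le_qform1 | exact: OmB].
Qed.

End ParallelForm.

(** * The cone form in a chart *)

Section Tractor.
Context {R : realType} {n : nat} {M : manifold R n}.
Variables (g : pseudo_metric M) (D : connection M) (alpha : M -> R).

(** The components of d alpha, as a row. *)
Definition diff_row (i : chart_index M) (x : 'rV[R]_n) : 'rV[R]_n :=
  \row_a d_comp alpha i a x.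

(** The components of the Hessian of alpha. *)
Definition hess_mx (i : chart_index M) (x : 'rV[R]_n) : 'M[R]_n :=
  \matrix_(a, b) hess_comp D alpha i a b x.

(** The form T on R + TM; the index 0 is that of e.  It is half the Hessian on
    the cone of r ^+ 2 * alpha, at r = 1. *)
Definition cone_hess (i : chart_index M) (x : 'rV[R]_n) : 'M[R]_(1 + n) :=
  block_mx (local_expr alpha i x)%:M (2^-1 *: diff_row i x)
    (2^-1 *: (diff_row i x)^T)
    (2^-1 *: hess_mx i x + local_expr alpha i x *: gram g i x).

(** The metric of the cone at r = 1. *)
Definition cone_metric (i : chart_index M) (x : 'rV[R]_n) : 'M[R]_(1 + n) :=
  block_mx 1%:M 0 0 (gram g i x).

(** The row [b] is made of the components of the covariant derivative of the
    [b]-th coordinate field in the direction [a]. *)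
Definition christoffel_mx (i : chart_index M) (a : 'I_n) (x : 'rV[R]_n) :
  'M[R]_n := \matrix_(b, k) symbols D i x a b 0 k.

(** The connection of R + TM in the direction [a]: e is sent to the [a]-th
    coordinate field, and the [b]-th coordinate field to
    - g_ab e + sum_k Gamma_ab^k d_k. *)
Definition cone_symbols (i : chart_index M) (a : 'I_n) (x : 'rV[R]_n) :
    'M[R]_(1 + n) :=
  block_mx 0 (delta_mx 0 a) (- col a (gram g i x)) (christoffel_mx i a x).

(** The multiple by [s] of T - mu G; it is used for [s] equal to 1 and -1. *)
Definition cone_form (s mu : R) (i : chart_index M) (x : 'rV[R]_n) :
  'M[R]_(1 + n) := s *: (cone_hess i x - mu *: cone_metric i x).

(** The third-order equation satisfied by alpha. *)
Definition gallot_tanno : Prop :=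
  forall (p : M) (i : chart_index M), chart_dom (atlas i) p ->
    forall X Y Z : 'rV[R]_n,
      ddd_at D alpha i p X Y Z
      + 2 * d_tensor_metric g alpha i p X Y Z
      + d_tensor_metric g alpha i p Y X Z
      + d_tensor_metric g alpha i p Z X Y = 0.

End Tractor.

Section Cone.
Context {R : realType} {n : nat} {M : manifold R n}.
Variables (g : pseudo_metric M) (D : connection M) (alpha : M -> R).
Hypotheses (hD : levi_civita g D) (halpha : smooth_function alpha).
Hypothesis heq : gallot_tanno g D alpha.
#[local] Set Implicit Arguments.
#[local] Unset Strict Implicit.
Implicit Types (i j : chart_index M) (x : 'rV[R]_n) (a b c : 'I_n).

Local Notation cod i := (chart_cod (atlas i)).
Local Notation cod_open i := (@open_cod R n M (atlas i)).

Lemma d_comp_smooth i a : smooth_on (cod i) (d_comp alpha i a).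
Proof. exact: smooth_partial. Qed.

Lemma hess_comp_sym i x a b : cod i x ->
  hess_comp D alpha i a b x = hess_comp D alpha i b a x.
Proof.
move=> ix; have [tf _] := hD.
have S := smooth_partialC a b (cod_open i) (halpha i) ix.
have -> : hess_comp D alpha i a b x =
  partial_deriv a (d_comp alpha i b) x
  - \sum_k symbols D i x a b 0 k * d_comp alpha i k x by [].
by rewrite (tf i x a b ix); rewrite S.
Qed.

(** The equation evaluated on coordinate fields. *)
Lemma nabla2_hess i x a b c : cod i x ->
  nabla2 D i (hess_comp D alpha i) a b c x =
  - (2 * d_comp alpha i a x * gram g i x b c + d_comp alpha i b x * gram g i x a c
     + d_comp alpha i c x * gram g i x a b).
Proof.
move=> ix.
have := heq _ _ (param_dom ix) (delta_mx 0 a) (delta_mx 0 b) (delta_mx 0 c).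
rewrite /ddd_at /d_tensor_metric /metric_at /d_at (paramK ix) => E.
have E3 : \sum_a0 \sum_b0 \sum_c0
    (delta_mx 0 a : 'rV[R]_n) 0 a0 * (delta_mx 0 b : 'rV[R]_n) 0 b0 *
    (delta_mx 0 c : 'rV[R]_n) 0 c0 * nabla2 D i (hess_comp D alpha i) a0 b0 c0 x =
  nabla2 D i (hess_comp D alpha i) a b c x.
  rewrite -[RHS](sum_delta (fun k => nabla2 D i (hess_comp D alpha i) k b c x)).
  apply: eq_bigr => a0 _.
  rewrite -[in RHS](sum_delta (fun k => nabla2 D i (hess_comp D alpha i) a0 k c x)).
  rewrite big_distrr; apply: eq_bigr => b0 _ /=.
  rewrite -[in RHS](sum_delta (fun k => nabla2 D i (hess_comp D alpha i) a0 b0 k x)).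
  by rewrite !big_distrr; apply: eq_bigr => c0 _ /=; rewrite !mulrA.
have E2 a1 b1 : \sum_a0 \sum_b0
    (delta_mx 0 a1 : 'rV[R]_n) 0 a0 * (delta_mx 0 b1 : 'rV[R]_n) 0 b0 *
    gram g i x a0 b0 = gram g i x a1 b1.
  rewrite -[RHS](sum_delta (fun k => gram g i x k b1)).
  apply: eq_bigr => a0 _.
  rewrite -[in RHS](sum_delta (fun k => gram g i x a0 k)).
  by rewrite big_distrr; apply: eq_bigr => b0 _ /=; rewrite !mulrA.
move: E; rewrite E3 !E2 !sum_delta => E; apply/eqP; rewrite -addr_eq0 -E.
move: (nabla2 _ _ _ _ _ _ _) (d_comp _ _ a x) (d_comp _ _ b x) (d_comp _ _ c x).
move: (gram g i x b c) (gram g i x a c) (gram g i x a b) => g1 g2 g3 t d1 d2 d3.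
by apply/eqP; ring.
Qed.

Lemma partial_gram i x a b c : cod i x ->
  partial_deriv a (fun y => gram g i y b c) x =
  \sum_k symbols D i x a b 0 k * gram g i x k c +
  \sum_k symbols D i x a c 0 k * gram g i x b k.
Proof.
move=> ix; have [_ mc] := hD; have := mc i x a b c ix.
by rewrite /nabla2 => /eqP; rewrite !subr_eq add0r addrC => /eqP.
Qed.

Lemma partial_hess i x a b c : cod i x ->
  partial_deriv a (hess_comp D alpha i b c) x =
  \sum_k symbols D i x a b 0 k * hess_comp D alpha i k c x +
  \sum_k symbols D i x a c 0 k * hess_comp D alpha i b k x
  - (2 * d_comp alpha i a x * gram g i x b c + d_comp alpha i b x * gram g i x a c
     + d_comp alpha i c x * gram g i x a b).
Proof.
by move=> ix; have := nabla2_hess a b c ix; rewrite /nabla2 => <-; ring.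
Qed.

Lemma partial_d i x a b :
  partial_deriv a (d_comp alpha i b) x =
  hess_comp D alpha i a b x + \sum_k symbols D i x a b 0 k * d_comp alpha i k x.
Proof. by rewrite /hess_comp /nabla1 subrK. Qed.

Lemma alpha_differentiable i x : cod i x -> differentiable (local_expr alpha i) x.
Proof. by move=> ix; exact: smooth_differentiable (cod_open i) (halpha i) ix. Qed.

Lemma d_differentiable i x a : cod i x -> differentiable (d_comp alpha i a) x.
Proof. by move=> ix; exact: smooth_differentiable (cod_open i) (@d_comp_smooth i a) ix. Qed.

Lemma gram_differentiable i x a b :
  cod i x -> differentiable (fun y => gram g i y a b) x.
Proof.
by move=> ix; exact: smooth_differentiable_entry (cod_open i) (@gram_smooth _ _ _ g i) ix.
Qed.

Lemma hess_differentiable i x a b :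
  cod i x -> differentiable (hess_comp D alpha i a b) x.
Proof.
move=> ix; have -> : hess_comp D alpha i a b =
    partial_deriv a (d_comp alpha i b) -
    \sum_k ((fun y => symbols D i y a b 0 k) * d_comp alpha i k).
  apply/funext => y; rewrite /hess_comp /nabla1 !fctE fct_sumE.
  by congr (_ - _); apply: eq_bigr => k _; rewrite !fctE.
apply: differentiableB.
  exact: smooth_differentiable (cod_open i) (smooth_partial a (@d_comp_smooth i b)) ix.
apply: differentiable_sum => k; apply: differentiableM; last exact: d_differentiable.
exact: smooth_differentiable_entry (cod_open i) (@symbols_smooth _ _ _ D i a b) ix.
Qed.

Lemma gram_entry_sym i x a b : cod i x -> gram g i x a b = gram g i x b a.
Proof. by move=> ix; rewrite -{1}(gram_sym g ix) mxE. Qed.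

Lemma christoffel_mull {k : nat} i a x (A : 'M[R]_(n, k)) b (c : 'I_k) :
  (christoffel_mx D i a x *m A) b c = \sum_l symbols D i x a b 0 l * A l c.
Proof. by rewrite mxE; apply: eq_bigr => l _; rewrite mxE. Qed.

Lemma christoffel_mulr {k : nat} i a x (A : 'M[R]_(k, n)) (b : 'I_k) c :
  (A *m (christoffel_mx D i a x)^T) b c = \sum_l symbols D i x a c 0 l * A b l.
Proof. by rewrite mxE; apply: eq_bigr => l _; rewrite !mxE mulrC. Qed.

(** The covariant derivative of a form is its derivative minus the right-hand
    side of the parallel equation, which is computed here for a symmetric
    block matrix. *)
Lemma cone_symbols_block i a x (u : R) (r : 'rV[R]_n) (S : 'M[R]_n) :
  S^T = S ->
  let T := block_mx u%:M r r^T S in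
  let G := christoffel_mx D i a x in
  let c := col a (gram g i x) in
  cone_symbols g D i a x *m T + T *m (cone_symbols g D i a x)^T =
  block_mx (2 * r 0 a)%:M (row a S - u *: c^T + r *m G^T)
    (row a S - u *: c^T + r *m G^T)^T
    (G *m S + S *m G^T - (c *m r + r^T *m c^T)).
Proof.
move=> sS T G c; rewrite /T /cone_symbols -/G -/c tr_block_mx.
rewrite !mulmx_block add_block_mx.
rewrite trmx0 !mul0mx !mulmx0 !add0r trmx_delta -!rowE -!colE.
congr block_mx.
- apply/matrixP => p q; rewrite !ord1 !mxE eqxx mulr1n; ring.
- rewrite mul_scalar_mx linearN /= scalerN; by rewrite !addrA.
- apply/matrixP => p q; rewrite [q]ord1.
  have -> : (row a S - u *: c^T + r *m G^T)^T = (row a S)^T - u *: c + G *m r^T.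
    by rewrite linearD linearB /= linearZ /= trmxK trmx_mul trmxK.
  rewrite tr_row sS mul_mx_scalar scalerN [in LHS]addrC.
  by rewrite -[in RHS]addrA.
- by rewrite mulNmx [(- c)^T]linearN mulmxN opprD addrACA [in LHS]addrC.
Qed.

(** T is parallel. *)
Lemma cone_hess_parallel i a x p q : cod i x ->
  is_derive x (delta_mx 0 a) (fun y => cone_hess g D alpha i y p q)
    ((cone_symbols g D i a x *m cone_hess g D alpha i x +
      cone_hess g D alpha i x *m (cone_symbols g D i a x)^T) p q).
Proof.
move=> ix.
have dA := is_derive_partial a (alpha_differentiable ix).
have dd b := is_derive_partial a (d_differentiable b ix).
have dH b c := is_derive_partial a (hess_differentiable b c ix).
have dG b c := is_derive_partial a (gram_differentiable b c ix).
have sS : (2^-1 *: hess_mx D alpha i x + local_expr alpha i x *: gram g i x)^T =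
    2^-1 *: hess_mx D alpha i x + local_expr alpha i x *: gram g i x.
  rewrite linearD !linearZ /= gram_sym //; congr (_ *: _ + _).
  by apply/matrixP => b c; rewrite !mxE hess_comp_sym.
rewrite {2 3}/cone_hess -[X in block_mx _ _ X _]linearZ /=.
rewrite (cone_symbols_block i a x _ _ sS).
have ru b : is_derive x (delta_mx 0 a)
    (fun y => 2^-1 * d_comp alpha i b y)
    ((row a (2^-1 *: hess_mx D alpha i x + local_expr alpha i x *: gram g i x)
     - local_expr alpha i x *: (col a (gram g i x))^T
     + 2^-1 *: diff_row alpha i x *m (christoffel_mx D i a x)^T) 0 b).
  have E : 2^-1 * partial_deriv a (d_comp alpha i b) x =
    (row a (2^-1 *: hess_mx D alpha i x + local_expr alpha i x *: gram g i x)
     - local_expr alpha i x *: (col a (gram g i x))^T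
     + 2^-1 *: diff_row alpha i x *m (christoffel_mx D i a x)^T) 0 b.
    rewrite mxE [X in _ = _ + X]christoffel_mulr.
    have -> : \sum_l symbols D i x a b 0 l * (2^-1 *: diff_row alpha i x) 0 l =
        2^-1 * \sum_l symbols D i x a b 0 l * d_comp alpha i l x.
      by rewrite big_distrr; apply: eq_bigr => l _; rewrite !mxE mulrCA.
    rewrite partial_d !mxE (gram_entry_sym b a ix); ring.
  by rewrite -E; exact: is_derive_mulfl.
case: (split_ordP p) => p' ->; case: (split_ordP q) => q' ->.
- under eq_fun => y do rewrite /cone_hess block_mxEul mxE !ord1 eqxx mulr1n.
  rewrite block_mxEul !ord1 !mxE eqxx mulr1n mulrA divff ?pnatr_eq0 // mul1r.
  exact: dA.
- under eq_fun => y do rewrite /cone_hess block_mxEur !mxE.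
  rewrite block_mxEur !ord1; exact: ru.
- under eq_fun => y do rewrite /cone_hess block_mxEdl !mxE.
  rewrite block_mxEdl !ord1 mxE; exact: ru.
under eq_fun => y do rewrite /cone_hess block_mxEdr !mxE.
rewrite block_mxEdr; rename p' into b, q' into c.
have E : 2^-1 * partial_deriv a (hess_comp D alpha i b c) x +
    (local_expr alpha i x * partial_deriv a (fun y => gram g i y b c) x
     + gram g i x b c * partial_deriv a (local_expr alpha i) x) =
  (christoffel_mx D i a x *m
     (2^-1 *: hess_mx D alpha i x + local_expr alpha i x *: gram g i x) +
   (2^-1 *: hess_mx D alpha i x + local_expr alpha i x *: gram g i x) *m
     (christoffel_mx D i a x)^T -
   (col a (gram g i x) *m (2^-1 *: diff_row alpha i x) +
    (2^-1 *: diff_row alpha i x)^T *m (col a (gram g i x))^T)) b c.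
  have outer : (col a (gram g i x) *m (2^-1 *: diff_row alpha i x) +
    (2^-1 *: diff_row alpha i x)^T *m (col a (gram g i x))^T) b c =
    2^-1 * (gram g i x a b * d_comp alpha i c x +
            d_comp alpha i b x * gram g i x a c).
    rewrite mxE [X in X + _]mxE big_ord1 [X in _ + X]mxE big_ord1 !mxE.
    rewrite (gram_entry_sym b a ix) (gram_entry_sym c a ix).
    by rewrite mulrDr mulrCA -mulrA.
  have mxB (A B : 'M[R]_n) : (A - B) b c = A b c - B b c by rewrite !mxE.
  have mxD (A B : 'M[R]_n) : (A + B) b c = A b c + B b c by rewrite mxE.
  have mxZ (k : R) (A : 'M[R]_n) : (k *: A) b c = k * A b c by rewrite mxE.
  rewrite mxB outer mulmxDl mulmxDr -!scalemxAl -!scalemxAr !(mxD, mxZ).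
  rewrite !christoffel_mull !christoffel_mulr partial_hess // partial_gram //.
  have -> : partial_deriv a (local_expr alpha i) x = d_comp alpha i a x by [].
  have hE l k : hess_mx D alpha i x l k = hess_comp D alpha i l k x.
    by rewrite mxE.
  under [in RHS]eq_bigr do rewrite hE.
  under [X in _ = _ + (_ * X + _) - _]eq_bigr do rewrite hE.
  move: (\sum_k symbols D i x a b 0 k * hess_comp D alpha i k c x) => s1.
  move: (\sum_k symbols D i x a c 0 k * hess_comp D alpha i b k x) => s2.
  move: (\sum_k symbols D i x a b 0 k * gram g i x k c) => s3.
  move: (\sum_k symbols D i x a c 0 k * gram g i x b k) => s4.
  move: (d_comp alpha i a x) (d_comp alpha i b x) (d_comp alpha i c x).
  move: (gram g i x b c) (gram g i x a c) (gram g i x a b) => g1 g2 g3 d1 d2 d3.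
  by move: (local_expr alpha i x) => u; field.
rewrite -E; apply: is_derive_addf; last exact: is_derive_mulf.
Qed.

(** G is parallel. *)
Lemma cone_metric_parallel i a x p q : cod i x ->
  is_derive x (delta_mx 0 a) (fun y => cone_metric g i y p q)
    ((cone_symbols g D i a x *m cone_metric g i x +
      cone_metric g i x *m (cone_symbols g D i a x)^T) p q).
Proof.
move=> ix.
have dG b c := is_derive_partial a (gram_differentiable b c ix).
have -> : cone_metric g i x = block_mx 1%:M 0 0^T (gram g i x) by rewrite trmx0.
rewrite (cone_symbols_block i a x 1 0 (gram_sym g ix)).
rewrite !(mul0mx, trmx0, mulmx0, addr0, subr0, scale1r).
have -> : row a (gram g i x) - (col a (gram g i x))^T = 0.
  by rewrite tr_col gram_sym // subrr.
rewrite trmx0 /cone_metric.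
case: (split_ordP p) => p' ->; case: (split_ordP q) => q' ->.
- under eq_fun => y do rewrite block_mxEul.
  rewrite block_mxEul !mxE mulr0 mul0rn; exact: is_derive_cst.
- under eq_fun => y do rewrite block_mxEur.
  rewrite block_mxEur mxE; exact: is_derive_cst.
- under eq_fun => y do rewrite block_mxEdl.
  rewrite block_mxEdl mxE; exact: is_derive_cst.
under eq_fun => y do rewrite block_mxEdr.
rewrite block_mxEdr mxE christoffel_mull christoffel_mulr -partial_gram //.
Qed.

Lemma cone_form_parallel s mu i a x p q : cod i x ->
  partial_deriv a (fun y => cone_form g D alpha s mu i y p q) x =
    (cone_symbols g D i a x *m cone_form g D alpha s mu i x +
      cone_form g D alpha s mu i x *m (cone_symbols g D i a x)^T) p q.
Proof.
move=> ix.
have dH := cone_hess_parallel a p q ix; have dM := cone_metric_parallel a p q ix.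
have -> : (fun y => cone_form g D alpha s mu i y p q) =
    (fun y => s * (cone_hess g D alpha i y p q + - mu * cone_metric g i y p q)).
  by apply/funext => y; rewrite !mxE mulNr.
rewrite /partial_deriv.
have [_ ->] :=
  is_derive_mulfl s (is_derive_addf dH (is_derive_mulfl (- mu) dM)).
rewrite /cone_form -scalemxAl -scalemxAr -scalerDr [RHS]mxE; congr (_ * _).
rewrite -scaleNr mulmxDl mulmxDr -scalemxAl -scalemxAr addrACA -scalerDr.
by rewrite [RHS]mxE; congr (_ + _); rewrite [RHS]mxE.
Qed.

Lemma cone_form_sym s mu i x : cod i x ->
  (cone_form g D alpha s mu i x)^T = cone_form g D alpha s mu i x.
Proof.
move=> ix; have sG : (cone_metric g i x)^T = cone_metric g i x.
  by rewrite tr_block_mx tr_scalar_mx !trmx0 gram_sym.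
have sH : (hess_mx D alpha i x)^T = hess_mx D alpha i x.
  by apply/matrixP => b c; rewrite !mxE hess_comp_sym.
have sT : (cone_hess g D alpha i x)^T = cone_hess g D alpha i x.
  rewrite tr_block_mx tr_scalar_mx !linearZ /= trmxK.
  by congr block_mx; rewrite linearD !linearZ /= sH gram_sym.
by rewrite linearZ /= linearB /= linearZ /= sT sG.
Qed.

Lemma cone_form_differentiable s mu i x p q : cod i x ->
  differentiable (fun y => cone_form g D alpha s mu i y p q) x.
Proof.
move=> ix.
have -> : (fun y => cone_form g D alpha s mu i y p q) =
    (fun y => s * (cone_hess g D alpha i y p q + - mu * cone_metric g i y p q)).
  by apply/funext => y; rewrite !mxE mulNr.
apply: differentiable_mulfl; apply: differentiableD; last first.
  apply: differentiable_mulfl; rewrite /cone_metric.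
  case: (split_ordP p) => p' ->; case: (split_ordP q) => q' ->.
  - under eq_fun => y do rewrite block_mxEul; exact: differentiable_cst.
  - under eq_fun => y do rewrite block_mxEur; exact: differentiable_cst.
  - under eq_fun => y do rewrite block_mxEdl; exact: differentiable_cst.
  under eq_fun => y do rewrite block_mxEdr; exact: gram_differentiable.
rewrite /cone_hess.
case: (split_ordP p) => p' ->; case: (split_ordP q) => q' ->.
- under eq_fun => y do rewrite block_mxEul mxE !ord1 eqxx mulr1n.
  exact: alpha_differentiable.
- under eq_fun => y do rewrite block_mxEur !mxE.
  by apply: differentiable_mulfl; exact: d_differentiable.
- under eq_fun => y do rewrite block_mxEdl !mxE.
  by apply: differentiable_mulfl; exact: d_differentiable.
under eq_fun => y do rewrite block_mxEdr !mxE.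
apply: differentiableD.
  by apply: differentiable_mulfl; exact: hess_differentiable.
by apply: differentiableM; [exact: alpha_differentiable | exact: gram_differentiable].
Qed.

Lemma cone_symbols_differentiable i a x p q : cod i x ->
  differentiable (fun y => cone_symbols g D i a y p q) x.
Proof.
move=> ix; rewrite /cone_symbols.
case: (split_ordP p) => p' ->; case: (split_ordP q) => q' ->.
- under eq_fun => y do rewrite block_mxEul; exact: differentiable_cst.
- under eq_fun => y do rewrite block_mxEur; exact: differentiable_cst.
- under eq_fun => y do rewrite block_mxEdl !mxE.
  by apply: differentiableN; exact: gram_differentiable.
under eq_fun => y do rewrite block_mxEdr !mxE.
exact: smooth_differentiable_entry (cod_open i) (@symbols_smooth _ _ _ D i a p') ix.
Qed.

(** Positive semidefiniteness propagates along a segment contained in the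
    codomain of a chart. *)
Lemma cone_form_psd_segment s mu i x0 x1 :
  (forall t : R, 0 <= t <= 1 -> cod i (x0 + t *: (x1 - x0))) ->
  psd (cone_form g D alpha s mu i x0) -> psd (cone_form g D alpha s mu i x1).
Proof.
set w := x1 - x0 => seg.
pose F (t : R) := cone_form g D alpha s mu i (x0 + t *: w).
pose Om (t : R) := \sum_a w 0 a *: cone_symbols g D i a (x0 + t *: w).
have omE (t : R) p q : Om t p q = \sum_a w 0 a * cone_symbols g D i a (x0 + t *: w) p q.
  by rewrite /Om summxE; apply: eq_bigr => a _; rewrite mxE.
have dOm p q (t : R) : 0 <= t <= 1 -> derivable (fun r => Om r p q) t 1.
  move=> t01; pose f (y : 'rV[R]_n) := \sum_a w 0 a * cone_symbols g D i a y p q.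
  have -> : (fun r => Om r p q) = (fun r => f (x0 + r *: w)).
    by apply/funext => r; rewrite omE.
  suff df : differentiable f (x0 + t *: w).
    by case: (is_derive_line f x0 w t (diff_derivable df)).
  have -> : f = \sum_a (fun y => w 0 a * cone_symbols g D i a y p q).
    by apply/funext => y; rewrite fct_sumE.
  apply: differentiable_sum => a; apply: differentiable_mulfl.
  exact/cone_symbols_differentiable/seg.
have bOm (pq : 'I_(1 + n) * 'I_(1 + n)) :
    exists B, forall t : R, 0 <= t <= 1 -> `|Om t pq.1 pq.2| <= B.
  exact/derivable_bounded_unit/dOm.
have [B BP] := choice bOm.
have F0 : F 0 = cone_form g D alpha s mu i x0 by rewrite /F scale0r addr0.
have F1 : F 1 = cone_form g D alpha s mu i x1 by rewrite /F scale1r /w addrC subrK.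
rewrite -F0 -F1; apply: (@parallel_psd R (1 + n) F Om (\sum_pq `|B pq|)).
- move=> t t01 p q; have it := seg t t01.
  have dF := cone_form_differentiable s mu p q it.
  apply: is_derive_eq (is_derive_line _ x0 w t (diff_derivable dF)) _.
  rewrite derive_coordE // mulmx_suml linear_sum /= mulmx_sumr -big_split summxE.
  apply: eq_bigr => a _; rewrite cone_form_parallel // -/(F t).
  have -> (A : 'M[R]_(1 + n)) : (w 0 a *: A)^T = w 0 a *: A^T by rewrite linearZ.
  move: (F t) (cone_symbols _ _ _ _ _) => Ft C /=.
  by rewrite -scalemxAl -scalemxAr -scalerDr [RHS]mxE.
- by move=> t t01; exact/cone_form_sym/seg.
- move=> t t01 p q; apply: le_trans (BP (p, q) t t01) _.
  by rewrite (bigD1 (p, q)) //= (le_trans (ler_norm _)) // lerDl sumr_ge0.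
Qed.

End Cone.

(** * Change of chart *)

Section ChartChange.
Context {R : realType} {n : nat} {M : manifold R n}.
Variables (g : pseudo_metric M) (D : connection M) (alpha : M -> R).
Hypothesis halpha : smooth_function alpha.
#[local] Set Implicit Arguments.
#[local] Unset Strict Implicit.
Variables (i j : chart_index M).
Implicit Types (x : 'rV[R]_n) (a b c d : 'I_n).

Local Notation O := (chart_overlap (atlas i) (atlas j)).
Local Notation tau := (chart_transition (atlas i) (atlas j)).

Lemma chart_overlap_open : open O.
Proof.
rewrite openE => x [ix jx]; apply: filterI.
  exact: open_nbhs_nbhs (conj (@open_cod _ _ _ (atlas i)) ix).
apply: (continuous_param ix).
exact: open_nbhs_nbhs (conj (@open_dom _ _ _ (atlas j)) jx).
Qed.

Lemma transition_cod x : O x -> chart_cod (atlas j) (tau x).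
Proof. by case=> _ jx; exact: coord_cod. Qed.

Lemma local_expr_transition x :
  O x -> local_expr alpha i x = local_expr alpha j (tau x).
Proof.
by case=> _ jx; rewrite /local_expr /chart_transition /= coordK.
Qed.

Lemma transition_differentiable x : O x -> differentiable tau x.
Proof.
move=> Ox; exact: smooth_differentiable_mx chart_overlap_open
                    (@atlas_compatible _ _ M i j) Ox.
Qed.

Lemma transition_jacobianE x a c :
  O x -> 'J tau x a c = partial_deriv a tau x 0 c.
Proof. by move=> Ox; exact/jacobianE/transition_differentiable. Qed.

Lemma d_comp_transition x a : O x ->
  d_comp alpha i a x = \sum_c 'J tau x a c * d_comp alpha j c (tau x).
Proof.
move=> Ox; rewrite -(partial_comp a (transition_differentiable Ox)); last first.
  exact: alpha_differentiable halpha _ _ (transition_cod Ox).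
apply: near_eq_derive; apply: open_near chart_overlap_open Ox _ => y Oy.
exact: local_expr_transition.
Qed.

(** The two terms of the derivative of [d_comp_transition]: the second
    derivatives of the change of chart, and those of alpha. *)
Lemma partial_d_transition x a b : O x ->
  partial_deriv a (d_comp alpha i b) x =
  \sum_d (partial_deriv a (partial_deriv b tau) x 0 d * d_comp alpha j d (tau x) +
          'J tau x b d *
          \sum_c 'J tau x a c * partial_deriv c (d_comp alpha j d) (tau x)).
Proof.
move=> Ox.
pose f d (y : 'rV[R]_n) := partial_deriv b tau y 0 d * (d_comp alpha j d \o tau) y.
have -> : partial_deriv a (d_comp alpha i b) x = partial_deriv a (\sum_d f d) x.
  apply: near_eq_derive; apply: open_near chart_overlap_open Ox _ => y Oy.
  rewrite d_comp_transition // fct_sumE; apply: eq_bigr => d _.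
  by rewrite transition_jacobianE.
have df d : is_derive x (delta_mx 0 a) (f d)
   (partial_deriv a (partial_deriv b tau) x 0 d * d_comp alpha j d (tau x) +
     'J tau x b d *
     \sum_c 'J tau x a c * partial_deriv c (d_comp alpha j d) (tau x)).
  have st := smooth_partial b (@atlas_compatible _ _ M i j).
  have dt : derivable (partial_deriv b tau) x (delta_mx 0 a).
    exact: smooth_derivable st Ox.
  have d1 : is_derive x (delta_mx 0 a) (fun y => partial_deriv b tau y 0 d)
      (partial_deriv a (partial_deriv b tau) x 0 d).
    have -> : partial_deriv a (partial_deriv b tau) x 0 d =
        'D_(delta_mx 0 a) (fun y => partial_deriv b tau y 0 d) x.
      by rewrite derive_entry.
    apply: derivableP.
    exact: (derivable_mxP (partial_deriv b tau) x (delta_mx 0 a)).1 dt 0 d.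
  have dj := d_differentiable halpha d (transition_cod Ox).
  have dtau := transition_differentiable Ox.
  have d2 := is_derive_partial a (differentiable_comp dtau dj).
  apply: is_derive_eq (is_derive_mulf d1 d2) _.
  rewrite partial_comp // -transition_jacobianE // addrC.
  by congr (_ + _); rewrite mulrC.
by rewrite /partial_deriv derive_sum //; apply: eq_bigr => d _; case: (df d).
Qed.

(** The second derivatives of the change of chart cancel against those in the
    transformation rule of the Christoffel symbols. *)
Lemma hess_comp_transition x a b : O x ->
  hess_comp D alpha i a b x =
  \sum_d \sum_c 'J tau x a c * 'J tau x b d * hess_comp D alpha j c d (tau x).
Proof.
move=> Ox.
have G : \sum_k symbols D i x a b 0 k * d_comp alpha i k x =
    \sum_d (symbols D i x a b *m 'J tau x) 0 d * d_comp alpha j d (tau x).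
  under eq_bigr do rewrite d_comp_transition // big_distrr /=.
  rewrite exchange_big /=; apply: eq_bigr => d _.
  by rewrite mxE big_distrl; apply: eq_bigr => k _; rewrite mulrA.
rewrite /hess_comp /nabla1 G partial_d_transition // -sumrB.
rewrite symbols_change // -/tau.
have S d : (partial_deriv a (partial_deriv b tau) x +
   \sum_c \sum_e ('J tau x a c * 'J tau x b e) *: symbols D j (tau x) c e) 0 d =
   partial_deriv a (partial_deriv b tau) x 0 d +
   \sum_c \sum_e 'J tau x a c * 'J tau x b e * symbols D j (tau x) c e 0 d.
  rewrite mxE summxE; congr (_ + _); apply: eq_bigr => c _.
  by rewrite summxE; apply: eq_bigr => e _; rewrite mxE.
under eq_bigr do rewrite S mulrDl opprD addrACA subrr add0r.
rewrite sumrB.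
have -> : \sum_d (\sum_c \sum_e 'J tau x a c * 'J tau x b e *
       symbols D j (tau x) c e 0 d) * d_comp alpha j d (tau x) =
   \sum_d \sum_c 'J tau x a c * 'J tau x b d *
     (\sum_k symbols D j (tau x) c d 0 k * d_comp alpha j k (tau x)).
  under eq_bigr do rewrite big_distrl /=.
  under eq_bigr do under eq_bigr do rewrite big_distrl /=.
  rewrite exchange_big [RHS]exchange_big /=; apply: eq_bigr => c _.
  rewrite exchange_big /=; apply: eq_bigr => d _.
  by rewrite big_distrr; apply: eq_bigr => k _ /=; rewrite mulrA.
rewrite -sumrB; apply: eq_bigr => d _.
rewrite big_distrr -sumrB; apply: eq_bigr => c _ /=.
by rewrite mulrBr mulrCA mulrA.
Qed.

Lemma cone_form_transition s mu x : O x ->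
  let A := block_mx 1%:M 0 0 ('J tau x) in
  cone_form g D alpha s mu i x = A *m cone_form g D alpha s mu j (tau x) *m A^T.
Proof.
move=> Ox A.
have hG : cone_metric g i x = A *m cone_metric g j (tau x) *m A^T.
  rewrite /A /cone_metric tr_block_mx !mulmx_block !trmx0 tr_scalar_mx.
  rewrite !(mul0mx, mulmx0, mul1mx, mulmx1, addr0, add0r).
  by rewrite (gram_change g Ox).
have dr : diff_row alpha i x = diff_row alpha j (tau x) *m ('J tau x)^T.
  apply/rowP => a; rewrite !mxE d_comp_transition //; apply: eq_bigr => c _.
  by rewrite !mxE mulrC.
have hr : hess_mx D alpha i x =
    'J tau x *m hess_mx D alpha j (tau x) *m ('J tau x)^T.
  apply/matrixP => a b; rewrite !mxE hess_comp_transition //.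
  apply: eq_bigr => d _; rewrite !mxE big_distrl; apply: eq_bigr => c _ /=.
  by rewrite !mxE mulrAC.
have hT : cone_hess g D alpha i x = A *m cone_hess g D alpha j (tau x) *m A^T.
  rewrite /A /cone_hess tr_block_mx !mulmx_block !trmx0 tr_scalar_mx.
  rewrite !(mul0mx, mulmx0, mul1mx, mulmx1, addr0, add0r).
  rewrite -local_expr_transition // dr trmx_mul trmxK hr (gram_change g Ox) -/tau.
  rewrite -!scalemxAl -!scalemxAr mulmxDr mulmxDl.
  by rewrite -!scalemxAr -!scalemxAl.
rewrite /cone_form hT hG -scalemxAr -scalemxAl mulmxBr mulmxBl.
by rewrite -[in RHS]scalemxAr -[in RHS]scalemxAl.
Qed.

Lemma psd_cone_form_transition s mu x : O x ->
  psd (cone_form g D alpha s mu j (tau x)) -> psd (cone_form g D alpha s mu i x).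
Proof. by move=> Ox pj; rewrite cone_form_transition //; exact: psd_congr. Qed.

End ChartChange.

(** * The cone form at an extremum *)

Section Extremum.
Context {R : realType} {n : nat} {M : manifold R n}.
Variables (g : pseudo_metric M) (D : connection M) (alpha : M -> R).
Hypothesis halpha : smooth_function alpha.
#[local] Set Implicit Arguments.
#[local] Unset Strict Implicit.
Implicit Types (i : chart_index M) (x w : 'rV[R]_n) (a b : 'I_n).

Local Notation cod i := (chart_cod (atlas i)).
Local Notation cod_open i := (@open_cod R n M (atlas i)).

(** First and second order conditions at a minimum of
    [s * (local_expr alpha i y - mu)] in the direction [w]. *)
Lemma extremum_second_order (s mu : R) i x w :
  cod i x -> s * (local_expr alpha i x - mu) = 0 ->
  (forall y, cod i y -> 0 <= s * (local_expr alpha i y - mu)) ->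
  s * \sum_a w 0 a * d_comp alpha i a x = 0 /\
  0 <= s * \sum_a \sum_b w 0 a * w 0 b * partial_deriv a (d_comp alpha i b) x.
Proof.
move=> ix s0 spos.
pose Phi (y : 'rV[R]_n) := \sum_b w 0 b * d_comp alpha i b y.
have dPhi : differentiable Phi x.
  have -> : Phi = \sum_b (fun y => w 0 b * d_comp alpha i b y).
    by apply/funext => y; rewrite fct_sumE.
  apply: differentiable_sum => b; apply: differentiable_mulfl.
  exact: d_differentiable.
have near_cod : \forall t \near (0 : R), cod i (x + t *: w).
  by apply: near_line; apply: open_near (cod_open i) ix _.
pose f (t : R) := s * (local_expr alpha i (x + t *: w) + - mu).
pose h (t : R) := s * Phi (x + t *: w).
have df : \forall t \near (0 : R), is_derive t (1 : R) f (h t).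
  apply: filterS near_cod => t it.
  have dA := alpha_differentiable halpha it.
  apply: is_derive_mulfl.
  have dl := is_derive_line _ x w t (diff_derivable dA).
  rewrite derive_coordE // in dl.
  rewrite -[Phi _]addr0; apply: is_derive_addf; exact: is_derive_cst.
have dh : is_derive (0 : R) (1 : R) h
    (s * \sum_a \sum_b w 0 a * w 0 b * partial_deriv a (d_comp alpha i b) x).
  apply: is_derive_mulfl.
  have dPhi0 : differentiable Phi (x + 0 *: w) by rewrite scale0r addr0.
  apply: is_derive_eq (is_derive_line _ x w 0 (diff_derivable dPhi0)) _.
  rewrite derive_coordE // scale0r addr0; apply: eq_bigr => a _.
  have -> : partial_deriv a Phi x =
      \sum_b w 0 b * partial_deriv a (d_comp alpha i b) x.
    have -> : Phi = \sum_b (fun y => w 0 b * d_comp alpha i b y).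
      by apply/funext => y; rewrite fct_sumE.
    have dd b := is_derive_mulfl (w 0 b)
      (is_derive_partial a (d_differentiable halpha b ix)).
    by rewrite /partial_deriv derive_sum //; apply: eq_bigr => b _; case: (dd b).
  rewrite [LHS]big_distrr /=; apply: eq_bigr => b _; exact: mulrA.
have fmin : \forall t \near (0 : R), f 0 <= f t.
  apply: filterS near_cod => t it.
  by rewrite /f scale0r addr0 s0; exact: spos.
have [h0 L0] := second_derivative_min df dh fmin.
by split=> //; move: h0; rewrite /h scale0r addr0.
Qed.

Lemma cone_form_psd_extremum (s mu : R) i x :
  cod i x -> s * (local_expr alpha i x - mu) = 0 ->
  (forall y, cod i y -> 0 <= s * (local_expr alpha i y - mu)) ->
  psd (cone_form g D alpha s mu i x).
Proof.
move=> ix s0 spos.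
have sd a : s * d_comp alpha i a x = 0.
  have [] := extremum_second_order (delta_mx 0 a) ix s0 spos.
  by rewrite sum_delta.
(* At an extremum only the Hessian block survives. *)
have -> : cone_form g D alpha s mu i x =
    block_mx 0 0 0 ((s / 2) *: hess_mx D alpha i x).
  rewrite /cone_form /cone_hess /cone_metric.
  rewrite scale_block_mx opp_block_mx add_block_mx scale_block_mx.
  congr block_mx.
  - by apply/matrixP => p q; rewrite !ord1 !mxE eqxx !mulr1n mulr1.
  - by apply/matrixP => p q; rewrite !mxE mulr0 subr0 mulrCA sd mulr0.
  - by apply/matrixP => p q; rewrite !mxE mulr0 subr0 mulrCA sd mulr0.
  - apply/matrixP => p q; rewrite !mxE -addrA -mulrBl mulrDr mulrA.
    by rewrite [X in _ + X]mulrA s0 mul0r addr0.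
move=> v; rewrite -[v]hsubmxK /qform tr_row_mx mul_row_block mul_row_col.
rewrite !(mulmx0, mul0mx, add0r) -/(qform _ _) qformZ.
move: (rsubmx v) => w.
rewrite mulrAC divr_ge0 //.
have [_] := extremum_second_order w ix s0 spos.
congr (0 <= _); rewrite qformE !big_distrr; apply: eq_bigr => a _.
rewrite !big_distrr; apply: eq_bigr => b _ /=.
rewrite mxE (partial_d D) mulrDr mulrDr.
have -> : s * (w 0 a * w 0 b *
    \sum_k symbols D i x a b 0 k * d_comp alpha i k x) = 0.
  rewrite mulrCA big_distrr big1 ?mulr0 // => k _ /=.
  by rewrite mulrCA sd mulr0.
by rewrite addr0 mulrAC.
Qed.

End Extremum.

(** * Propagation over the manifold *)

Section Global.
Context {R : realType} {n : nat} {M : manifold R n}.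
Variables (g : pseudo_metric M) (D : connection M) (alpha : M -> R).
Hypotheses (hD : levi_civita g D) (halpha : smooth_function alpha).
Hypothesis heq : gallot_tanno g D alpha.
Hypothesis hconnected : connected [set: M].
#[local] Set Implicit Arguments.
#[local] Unset Strict Implicit.

Local Notation psd_at s mu i p :=
  (psd (cone_form g D alpha s mu i (chart_coord (atlas i) p))).

Lemma psd_at_chart (s mu : R) i j (p : M) :
  chart_dom (atlas i) p -> chart_dom (atlas j) p ->
  psd_at s mu j p -> psd_at s mu i p.
Proof.
move=> ip jp pj; apply: (psd_cone_form_transition halpha (j := j)).
  by split; [exact: coord_cod | rewrite /= coordK].
by rewrite /chart_transition /= coordK.
Qed.

(** Positive semidefiniteness is locally constant: nearby points are joined to
    [p] by a segment in the chart, which can be travelled in both directions. *)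
Lemma psd_at_near (s mu : R) i (p : M) : chart_dom (atlas i) p ->
  \forall q \near p, chart_dom (atlas i) q /\
    (psd_at s mu i p <-> psd_at s mu i q).
Proof.
move=> ip; set x := chart_coord (atlas i) p.
have ix : chart_cod (atlas i) x by exact: coord_cod.
have /nbhs_normP[r r0 rP] : nbhs x (chart_cod (atlas i)).
  exact: open_nbhs_nbhs (conj (@open_cod _ _ _ (atlas i)) ix).
have inr (y z : 'rV[R]_n) (t : R) : `|y - x| < r -> 0 <= t <= 1 ->
    z - x = t *: (y - x) -> chart_cod (atlas i) z.
  move=> yr /andP[t0 t1] E; apply: rP; rewrite /= distrC E normrZ ger0_norm //.
  by apply: le_lt_trans yr; rewrite ler_piMl.
have close : \forall q \near p, `|chart_coord (atlas i) q - x| < r.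
  have /cvgrPdist_lt/(_ _ r0) := @continuous_coord _ _ _ (atlas i) p ip.
  by apply: filterS => q; rewrite distrC.
have dom : \forall q \near p, chart_dom (atlas i) q.
  exact: open_nbhs_nbhs (conj (@open_dom _ _ _ (atlas i)) ip).
apply: filterS2 close dom => q; set y := chart_coord (atlas i) q => yr iq.
split; first exact: iq.
split; apply: (cone_form_psd_segment hD halpha heq) => t t01.
  by apply: (inr y _ t yr t01); rewrite addrC addrA addNr add0r.
apply: (inr y _ (1 - t) yr); first by rewrite subr_ge0 lerBlDr; lra.
by rewrite scalerBl scale1r -[x - y]opprB scalerN addrAC.
Qed.

(** The set of points where the form is positive semidefinite is open, closed
    and nonempty. *)
Lemma psd_everywhere (s mu : R) (i0 : chart_index M) (p0 : M) :
  chart_dom (atlas i0) p0 -> psd_at s mu i0 p0 ->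
  forall i p, chart_dom (atlas i) p -> psd_at s mu i p.
Proof.
move=> ip0 P0.
pose A : set M := [set p | exists2 i, chart_dom (atlas i) p & psd_at s mu i p].
have oA : open A.
  rewrite openE => p [i ip Pi]; apply: filterS (psd_at_near s mu ip) => q [iq E].
  by exists i; [exact: iq | exact: E.1 Pi].
have cA : closed A.
  rewrite -openC openE => p nA; have [i ip] := atlas_cover p.
  apply: filterS (psd_at_near s mu ip) => q [iq E] [j jq Pj].
  by apply: nA; exists i; [exact: ip | exact: E.2 (psd_at_chart iq jq Pj)].
have AT : A = [set: M].
  apply: hconnected; first by exists p0; exists i0.
  - by exists A => //; rewrite setTI.
  - by exists A => //; rewrite setTI.
move=> i p ip; have [j jp Pj] : A p by rewrite AT.
exact: psd_at_chart Pj.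
Qed.

End Global.

Lemma smooth_function_continuous {R : realType} {n : nat} {M : manifold R n}
    (alpha : M -> R) : smooth_function alpha -> continuous alpha.
Proof.
move=> halpha p; have [i ip] := atlas_cover p.
have E : \forall q \near p,
    (local_expr alpha i \o chart_coord (atlas i)) q = alpha q.
  apply: open_near (@open_dom _ _ _ (atlas i)) ip _ => q iq.
  by rewrite /local_expr /= coordK.
apply: near_eq_continuous E _; apply: continuous_comp.
  exact: continuous_coord.
exact: smooth_continuous (halpha i) (coord_cod ip).
Qed.

(** In both signatures (n - 1, 1) and (1, n - 1) the last diagonal entry is -1,
    as n is at least 2. *)
Lemma lorentzian_timelike {R : realType} {n : nat} {M : manifold R n}
    (g : pseudo_metric M) i x :
  (2 <= n)%N -> lorentzian g -> chart_cod (atlas i) x ->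
  exists w, qform (gram g i x) w < 0.
Proof.
move=> hn hg ix.
have n1 : (n.-1 < n)%N by rewrite prednK // ltnW.
pose k := Ordinal n1.
suff [P PG] : exists P : 'M[R]_n, (P *m gram g i x *m P^T) k k = -1.
  exists (delta_mx 0 k *m P); rewrite -qform_congr /qform trmx_delta -rowE -colE.
  by rewrite mxE mxE PG oppr_lt0.
case: hg => [/(_ i x ix)|/(_ i x ix)] [_ [P _ E]];
  exists P; rewrite E !mxE eqxx mulr1n /=.
  by rewrite ltnn.
by rewrite ltnNge -ltnS prednK ?hn // ltnW.
Qed.

Theorem corollary3p12 (R : realType) (n : nat) (hn : (2 <= n)%N)
    (M : manifold R n)
    (hcompact : compact [set: M]) (hconnected : connected [set: M])
    (g : pseudo_metric M) (hg : lorentzian g)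
    (D : connection M) (hD : levi_civita g D)
    (alpha : M -> R) (halpha : smooth_function alpha)
    (heq : forall (p : M) (i : chart_index M), chart_dom (atlas i) p ->
      forall X Y Z : 'rV[R]_n,
        ddd_at D alpha i p X Y Z
        + 2 * d_tensor_metric g alpha i p X Y Z
        + d_tensor_metric g alpha i p Y X Z
        + d_tensor_metric g alpha i p Z X Y = 0) :
  exists c : R, forall p : M, alpha p = c.
Proof.
have [[p0 _]|M0] := pselect ([set: M] !=set0); last first.
  by exists 0 => p; case: M0; exists p.
have ac : {within [set: M], continuous alpha}.
  exact/continuous_subspaceT/smooth_function_continuous.
have MT : [set: M] !=set0 by exists p0.
have [pmax _ maxP] := compact_EVT_max MT hcompact ac.
have [pmin _ minP] := compact_EVT_min MT hcompact ac.
have {}maxP p : alpha p <= alpha pmax by apply: maxP; rewrite inE.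
have {}minP p : alpha pmin <= alpha p by apply: minP; rewrite inE.
have [lt|le] := ltP (alpha pmin) (alpha pmax); last first.
  exists (alpha pmin) => p; apply/eqP; rewrite eq_le minP andbT.
  exact: le_trans (maxP p) le.
have [i ip] := atlas_cover pmin; have [j jp] := atlas_cover pmax.
set x := chart_coord (atlas i) pmin.
have ix : chart_cod (atlas i) x by exact: coord_cod.
have P1 : psd (cone_form g D alpha 1 (alpha pmin) i x).
  apply: (cone_form_psd_extremum g D halpha ix) => [|y iy].
    by rewrite /local_expr /x /= coordK // subrr mulr0.
  by rewrite mul1r subr_ge0; exact: minP.
have P2 : psd (cone_form g D alpha (- 1) (alpha pmax) i x).
  apply: (psd_everywhere hD halpha heq hconnected jp) ip.
  apply: (cone_form_psd_extremum g D halpha (coord_cod jp)) => [|y jy].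
    by rewrite /local_expr /= coordK // subrr mulr0.
  by rewrite mulN1r opprB subr_ge0; exact: maxP.
have [w w0] := lorentzian_timelike g i x hn hg ix.
exfalso.
(* The sum of the two forms is evaluated on (0, w), with w timelike. *)
have := addr_ge0 (P1 (row_mx 0 w)) (P2 (row_mx 0 w)); rewrite -qformD.
have -> : cone_form g D alpha 1 (alpha pmin) i x +
    cone_form g D alpha (- 1) (alpha pmax) i x =
    (alpha pmax - alpha pmin) *: cone_metric g i x.
  rewrite /cone_form; move: (cone_hess _ _ _ _ _) (cone_metric _ _ _) => T G.
  by rewrite scale1r scaleN1r opprB scalerBl addrC addrA subrK.
rewrite qformZ pmulr_rge0 ?subr_gt0 // leNgt => /negP; apply.
rewrite /qform /cone_metric tr_row_mx mul_row_block mul_row_col.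
by rewrite !(mulmx0, mul0mx, add0r).
Qed.
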